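(* Let $q$ be a prime power, $n \geq 5$, $\eta \in (0,1]$, and let $S \subset \mathbb{F}_q^n$ with $|S| > q^4$. Then there exists a constant $C_\eta > 0$ depending only on $\eta$ such that for any $\tau > 0$ and $\delta \in (0,1)$ satisfying $q^\eta \geq C_\eta \max(n(1+\tau)/(\tau\delta)^2,\, n)$, and any integer $1 \le k \le n$ satisfying $q^k|S| > q^{n+2+\eta}$, at least a $(1-\delta)$-fraction of all subspaces in $\mathcal{L}_k^*(\mathbb{F}_q^n)$ are $\tau$-shift-balanced with respect to $S$.
   Context: For $1 \le k \le n$, $\mathcal{L}_k(\mathbb{F}_q^n)$ denotes the set of $k$-dimensional affine subspaces ($k$-flats) of $\mathbb{F}_q^n$ and $\mathcal{L}_k^*(\mathbb{F}_q^n)$ the set of $k$-dimensional linear subspaces. For $S \subset \mathbb{F}_q^n$, $E_k(S) = |S|/q^{n-k}$. A flat $R \in \mathcal{L}_k(\mathbb{F}_q^n)$ is $\tau$-balanced with respect to $S$ if $\big||R \cap S| - E_k(S)\big| \leq \tau E_k(S)$, and $\tau$-unbalanced otherwise. A subspace $A \in \mathcal{L}_k^*(\mathbb{F}_q^n)$ is $\tau$-shift-balanced with respect to $S$ if for every $a \in \mathbb{F}_q^n$ the flat $A + a$ is $\tau$-balanced with respect to $S$. *)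

(* Defs.v *)
From HB Require Import structures.
From mathcomp Require Import all_boot all_order all_algebra all_field.
From mathcomp Require Import reals exp.
Set Implicit Arguments. Unset Strict Implicit. Unset Printing Implicit Defensive.
Import Order.TTheory GRing.Theory Num.Theory.
Local Open Scope ring_scope.

Section Flats.
Variables (R : realType) (F : finFieldType) (n : nat).
Local Notation V := 'rV[F]_n.

(* L_k^*(F_q^n): the k-dimensional linear subspaces, each given as its set of
   vectors, i.e. the row space of some n x n matrix of rank k. *)
Definition linsubs (k : nat) : {set {set V}} :=
  [set [set v : V | (v <= M)%MS] | M in [set M : 'M[F]_n | \rank M == k]].

Definition shift (A : {set V}) (a : V) : {set V} := [set v + a | v in A].

Definition Ek (k : nat) (S : {set V}) : R :=
  #|S|%:R / (#|F|%:R ^+ (n - k)).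

Definition balanced (k : nat) (tau : R) (S Rf : {set V}) : bool :=
  `| #|Rf :&: S|%:R - Ek k S | <= tau * Ek k S.

Definition shift_balanced (k : nat) (tau : R) (S A : {set V}) : bool :=
  [forall a : V, balanced k tau S (shift A a)].

End Flats.

(* Main.v *)
Require Import Defs.
From HB Require Import structures.
From mathcomp Require Import all_boot all_order all_algebra all_field.
From mathcomp Require Import reals exp.
From mathcomp Require Import zify ring lra.
Set Implicit Arguments. Unset Strict Implicit. Unset Printing Implicit Defensive.
Import Order.TTheory GRing.Theory Num.Theory.
Local Open Scope ring_scope.

(** Put p = n - k, m = p + 2, q = #|F| and let C be a uniformly random n x m
    matrix, viewed as a linear hash F^n -> F^m. By pairwise independence, very
    few points y of F^m have a fibre of S under C whose size is far from its
    mean, since this mean |S| / q^m exceeds q^eta. On the other hand a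
    k-dimensional subspace with an unbalanced shift corresponds to a plane
    direction b of F^m, and the second moment method inside that shift shows
    that some plane parallel to b consists almost entirely of such exceptional
    points. Hence every direction b has probability at least delta / 4 of being
    realized, and the union of the exceptional sets of about 8 / delta suitable
    matrices C contains almost all of a plane in a constant fraction of the
    directions, although it is still small.

    This contradicts a Kakeya theorem for planes, proved by the method of
    multiplicities. A polynomial P of degree D vanishing to high order on the
    set vanishes identically on the rich planes together with its Hasse
    derivatives of low order. Parametrizing a plane by
    tau = t_1 + z t_2, with z outside F and t_i^q = t_i, turns the restriction
    of P into a polynomial of degree at most D q in tau, whose leading
    coefficient is the top homogeneous part of P at (b_2 - z b_1) / (z^q - z).
    So this top part vanishes to high order on a constant fraction of a grid
    with side q^2, against the Schwartz-Zippel lemma with multiplicities. *)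

(** * Hasse derivatives and the Schwartz-Zippel lemma with multiplicities *)

Lemma mul_bin_trinomial n k l :
  ('C(n, k) * 'C(n - k, l) = 'C(n, k + l) * 'C(k + l, k))%N.
Proof.
have [lkn|] := leqP (k + l) n; last first.
  move=> ltn; rewrite (bin_small ltn) mul0n.
  by have [kn|kn] := leqP k n; [rewrite ['C(n - k, l)]bin_small ?muln0 //; lia
                               | rewrite bin_small].
have fgt0 : (0 < k`! * l`! * (n - (k + l))`!)%N by rewrite !muln_gt0 !fact_gt0.
apply/eqP; rewrite -(eqn_pmul2r fgt0); apply/eqP.
have e1 := @bin_fact n k; have e2 := @bin_fact (n - k) l.
have e3 := @bin_fact n (k + l); have e4 := @bin_fact (k + l) k.
rewrite addKn in e4; rewrite -subnDA in e2.
transitivity n`!.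
  by rewrite -e1 -?e2; lia.
by rewrite -e3 -?e4; lia.
Qed.

Section HasseDerivatives.
Variables (A : comNzRingType) (n N : nat).
Implicit Types (c : {ffun 'I_n -> 'I_N} -> A) (b : 'I_n -> nat) (x v : 'I_n -> A).

(* The value at x of the b-th Hasse derivative of the polynomial with
   coefficients c, that is, the coefficient of y^b in c(x + y). *)
Definition hasse c b x : A :=
  \sum_al c al * \prod_i (x i ^+ (al i - b i) *+ 'C(al i, b i)).

(** Binomial theorem for the exponent [k - b], regrouped by [mul_bin_trinomial]. Letting [l] run up
    to [N] makes the range independent of [k]; the surplus terms carry a vanishing binomial
    coefficient. *)
Lemma expr_hasse_taylor (k b : nat) (x v : A) : (k < N)%N ->
  (x + v) ^+ (k - b) *+ 'C(k, b) =
  \sum_(l < N) (x ^+ (k - (b + l)) *+ 'C(k, b + l)) * (v ^+ l *+ 'C(b + l, b)).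
Proof.
move=> kN; rewrite exprDn -sumrMnl.
rewrite (big_ord_widen N (fun l => x ^+ (k - b - l) * v ^+ l *+ 'C(k - b, l) *+ 'C(k, b))); last lia.
rewrite [RHS](bigID (fun l : 'I_N => (l < (k - b).+1)%N)) /= [X in _ + X]big1 ?addr0.
  apply: eq_bigr => l _; rewrite mulrnAr mulrnAl -!mulrnA subnDA.
  by rewrite mulnC mul_bin_trinomial.
move=> l lk; rewrite mulrnAr mulrnAl -mulrnA -mul_bin_trinomial.
by rewrite ['C(k - b, l)]bin_small ?muln0 ?mulr0n //; lia.
Qed.

Lemma hasse_taylor c b x v :
  hasse c b (fun i => x i + v i) =
  \sum_(g : {ffun 'I_n -> 'I_N})
     hasse c (fun i => b i + g i)%N x * \prod_i (v i ^+ g i *+ 'C(b i + g i, b i)).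
Proof.
rewrite /hasse; under [RHS]eq_bigr do rewrite big_distrl /=.
rewrite exchange_big /=; apply: eq_bigr => al _.
under [RHS]eq_bigr do rewrite -mulrA -big_split /=.
rewrite -big_distrr /=; congr (_ * _).
rewrite -(bigA_distr_bigA (fun i (l : 'I_N) =>
  (x i ^+ (al i - (b i + l)) *+ 'C(al i, b i + l)) *
  (v i ^+ l *+ 'C(b i + l, b i)))).
by apply: eq_bigr => i _; rewrite expr_hasse_taylor.
Qed.

Lemma eq_hasse c c' b b' x x' : c =1 c' -> b =1 b' -> x =1 x' ->
  hasse c b x = hasse c' b' x'.
Proof.
move=> ec eb ex; apply: eq_bigr => al _; rewrite ec; congr (_ * _).
by apply: eq_bigr => i _; rewrite eb ex.
Qed.

(* At an exponent al of maximal degree in the support of c, the al-th Hasse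
   derivative is the constant c al. *)
Lemma hasse_neq0 c al0 x : c al0 != 0 ->
  exists al : {ffun 'I_n -> 'I_N}, hasse c (fun i => al i) x != 0.
Proof.
move=> c0.
case: (@arg_maxnP _ al0 (fun al => c al != 0) (fun al => \sum_i al i)%N c0) => al cal amax.
exists al; rewrite /hasse (bigD1 al) //= [X in _ * X + _]big1 ?mulr1; last first.
  by move=> i _; rewrite subnn binn expr0.
rewrite big1 ?addr0 // => be nab; have [->|cbe] := eqVneq (c be) 0; first by rewrite mul0r.
have [le|] := boolP [forall i, al i <= be i]%N; last first.
  case/forallPn => i; rewrite -ltnNge => lt.
  by rewrite (bigD1 i) //= bin_small // mulr0n mul0r mulr0.
have {}le i : (al i <= be i)%N by apply/forallP: i.
have /leqif_sum [_ /esym] : forall i, true -> (al i <= be i ?= iff (al i == be i :> nat))%N.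
  by move=> i _; split.
rewrite eqn_leq leq_sum ?[(_ <= \sum_i al i)%N]amax // => /forallP eq.
by case/negP: nab; apply/eqP/ffunP => i; apply/val_inj/esym/eqP/eq.
Qed.

End HasseDerivatives.

Lemma rmorph_hasse (A B : comNzRingType) (f : {rmorphism A -> B}) n N
    (c : {ffun 'I_n -> 'I_N} -> A) b (x : 'I_n -> A) :
  f (hasse c b x) = hasse (f \o c) b (f \o x).
Proof.
rewrite /hasse rmorph_sum; apply: eq_bigr => al _.
rewrite rmorphM rmorph_prod; congr (_ * _); apply: eq_bigr => i _.
by rewrite rmorphMn rmorphXn.
Qed.

(** * Univariate polynomials: roots counted with multiplicity *)

Section Univariate.
Variable K : fieldType.

(** Powers of distinct linear factors are pairwise coprime, so their product divides [h]. *)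
Lemma sum_multiplicity (I : finType) (s : I -> K) (e : I -> nat) (h : {poly K}) :
  injective s -> h != 0 -> (forall i, ('X - (s i)%:P) ^+ e i %| h) ->
  (\sum_i e i <= (size h).-1)%N.
Proof.
move=> sI h0 dv; rewrite -ltnS prednK ?lt0n ?size_poly_eq0 //.
suff [dvP szP]: \prod_i ('X - (s i)%:P) ^+ e i %| h /\
    size (\prod_i ('X - (s i)%:P) ^+ e i) = (\sum_i e i).+1.
  by rewrite -szP dvdp_leq.
rewrite -!big_enum /=.
elim: (enum _) (enum_uniq I) => [_|i r IH /= /andP[ir /IH [IHd IHs]]].
  by rewrite !big_nil dvd1p size_poly1.
rewrite !big_cons; split; last first.
  by rewrite size_monicM ?monic_exp ?monicXsubC -?size_poly_gt0 ?IHs // size_exp_XsubC addSn addnS.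
rewrite Gauss_dvdp ?dv //; apply: coprimep_expl.
rewrite coprimep_sym coprimep_XsubC /root horner_prod prodf_seq_neq0.
apply/allP => j jr; rewrite /= !hornerE expf_neq0 // subr_eq0.
by apply: contraNneq ir => /sI ->.
Qed.

(** Re-expanded in powers of ['X - a], the polynomial has its Hasse derivatives at [a] as
    coefficients; the hypothesis kills the first [e] of them. *)
Lemma dvdp_of_vanishing N (c : 'I_N -> K) (a : K) (e : nat) :
  (forall i : 'I_N, (i < e)%N -> \sum_(k < N) c k * (a ^+ (k - i) *+ 'C(k, i)) = 0) ->
  ('X - a%:P) ^+ e %| \sum_(k < N) c k *: 'X^k.
Proof.
move=> van.
have -> : \sum_(k < N) c k *: 'X^k =
    \sum_(l < N) (\sum_(k < N) c k * (a ^+ (k - l) *+ 'C(k, l))) *: ('X - a%:P) ^+ l.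
  under [RHS]eq_bigr do rewrite scaler_suml.
  rewrite exchange_big /=; apply: eq_bigr => k _.
  have /= := expr_hasse_taylor 0 a%:P ('X - a%:P) (ltn_ord k).
  rewrite addrC subrK subn0 bin0 mulr1n => ->.
  rewrite scaler_sumr; apply: eq_bigr => l _.
  by rewrite add0n bin0 mulr1n -scalerA -polyC_exp -polyCMn mul_polyC.
apply: (big_ind (fun p => _ %| p)) => [|p q|l _]; [exact: dvdp0|exact: dvdp_add|].
have [lt|le] := ltnP l e; first by rewrite van // scale0r dvdp0.
by rewrite -mul_polyC dvdp_mull ?dvdp_exp2l.
Qed.

End Univariate.

(** * Splitting off the first variable, and the Schwartz-Zippel bound *)

Section FunCons.
Variables (T : finType) (n : nat).

Definition fcons (k : T) (g : {ffun 'I_n -> T}) : {ffun 'I_n.+1 -> T} :=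
  [ffun i => if unlift ord0 i is Some j then g j else k].

Lemma fcons0 k g : fcons k g ord0 = k.
Proof. by rewrite ffunE unlift_none. Qed.

Lemma fconsS k g j : fcons k g (lift ord0 j) = g j.
Proof. by rewrite ffunE liftK. Qed.

Lemma fcons_eta (f : {ffun 'I_n.+1 -> T}) :
  fcons (f ord0) [ffun j => f (lift ord0 j)] = f.
Proof.
by apply/ffunP => i; rewrite ffunE; case: unliftP => [j ->|->]; rewrite ?ffunE.
Qed.

Lemma big_fcons (V : Type) (idx : V) (op : Monoid.com_law idx)
    (G : {ffun 'I_n.+1 -> T} -> V) :
  \big[op/idx]_f G f = \big[op/idx]_k \big[op/idx]_g G (fcons k g).
Proof.
rewrite pair_bigA /=.
rewrite (reindex (fun kg : T * {ffun 'I_n -> T} => fcons kg.1 kg.2)) //=.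
exists (fun f : {ffun 'I_n.+1 -> T} => (f ord0, [ffun j => f (lift ord0 j)])).
  move=> [k g] _ /=; rewrite fcons0; congr (_, _).
  by apply/ffunP => j; rewrite ffunE fconsS.
by move=> f _; apply: fcons_eta.
Qed.

End FunCons.

Lemma hasse_fcons (A : comNzRingType) n N (c : {ffun 'I_n.+1 -> 'I_N} -> A)
    (b : 'I_n.+1 -> nat) (x : 'I_n.+1 -> A) :
  hasse c b x = \sum_k hasse (fun g => c (fcons k g)) (b \o lift ord0) (x \o lift ord0) *
                  (x ord0 ^+ (k - b ord0) *+ 'C(k, b ord0)).
Proof.
rewrite /hasse big_fcons; apply: eq_bigr => k _; rewrite big_distrl /=.
apply: eq_bigr => g _; rewrite big_ord_recl fcons0 -mulrA; congr (_ * _).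
by rewrite mulrC; congr (_ * _); apply: eq_bigr => i _; rewrite fconsS.
Qed.

(** Induction on the number of variables. Let [t] be the degree in the first variable and [ct] its
    leading coefficient. On the line over [a'], differentiating in the other variables up to the
    multiplicity of [ct] at [a'] leaves a nonzero univariate polynomial of degree [t], which bounds
    the weights on this line; the induction hypothesis bounds the multiplicities of [ct]. *)
Theorem schwartz_zippel_multiplicity (K : fieldType) (I : finType) (s : I -> K) (N n : nat)
    (c : {ffun 'I_n -> 'I_N} -> K) (D : nat) (w : {ffun 'I_n -> I} -> nat) :
  injective s ->
  (exists al, c al != 0) -> (forall al, c al != 0 -> (\sum_i al i <= D)%N) ->
  (forall a (b : {ffun 'I_n -> 'I_N}), (\sum_i b i < w a)%N ->
     hasse c (fun i => b i) (fun i => s (a i)) = 0) ->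
  (#|I| * \sum_a w a <= D * #|I| ^ n)%N.
Proof.
move=> sI; elim: n c D w => [|n IH] c D w [al0 cal0] degc van.
  rewrite big1 ?muln0 // => a _; apply/eqP; rewrite -leqn0 leqNgt; apply/negP => wa.
  have [b] := hasse_neq0 (fun i => s (a i)) cal0.
  by rewrite van ?eqxx // big_ord0.
have P0 : [exists g, c (fcons (al0 ord0) g) != 0].
  by apply/existsP; exists [ffun j => al0 (lift ord0 j)]; rewrite fcons_eta.
case: (@arg_maxnP _ _ (fun k => [exists g, c (fcons k g) != 0]) val P0) => t Pt tmax.
have sum_fcons k (g : {ffun 'I_n -> 'I_N}) : (\sum_i fcons k g i = k + \sum_i g i)%N.
  by rewrite big_ord_recl fcons0; congr addn; apply: eq_bigr => i _; rewrite fconsS.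
have tD : (t <= D)%N.
  by case/existsP: Pt => g /degc; rewrite sum_fcons; apply: leq_trans (leq_addr _ _).
pose ct g := c (fcons t g).
have ct0 : exists g, ct g != 0 by case/existsP: Pt => g; exists g.
(* A nonvanishing derivative of least order: its order is the multiplicity of [ct] at [a]. *)
pose minimal a (b0 : {ffun 'I_n -> 'I_N}) :=
  hasse ct (fun i => b0 i) (fun i => s (a i)) != 0 /\
  forall b : {ffun 'I_n -> 'I_N}, (\sum_i b i < \sum_i b0 i)%N ->
    hasse ct (fun i => b i) (fun i => s (a i)) = 0.
have /fin_all_exists[be be_spec] : forall a : {ffun 'I_n -> I}, exists b0, minimal a b0.
  move=> a.
  have [g0 cg0] := ct0.
  have [b0 hb0] := hasse_neq0 (fun i => s (a i)) cg0.
  case: (@arg_minnP _ _ (fun b : {ffun 'I_n -> 'I_N} =>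
    hasse ct (fun i => b i) (fun i => s (a i)) != 0)
    (fun b => \sum_i b i)%N hb0) => b hb bmin.
  exists b; split=> // b' lt; apply/eqP/negPn/negP => /bmin.
  by rewrite leqNgt lt.
have degct g : ct g != 0 -> (\sum_i g i <= D - t)%N by move/degc; rewrite sum_fcons leq_subRL.
have {}IH := IH ct (D - t)%N (fun a => \sum_i be a i)%N ct0 degct (fun a => (be_spec a).2).
have fiber (a' : {ffun 'I_n -> I}) :
    (\sum_a w (fcons a a') <= t + #|I| * \sum_i be a' i)%N.
  set mu := (\sum_i be a' i)%N.
  pose h := \sum_(k < N) hasse (fun g => c (fcons k g)) (fun i => be a' i)
                           (fun i => s (a' i)) *: 'X^k.
  have hE : h = \poly_(k < N) (if insub k is Some k' then
     hasse (fun g => c (fcons k' g)) (fun i => be a' i) (fun i => s (a' i)) else 0).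
    by rewrite poly_def; apply: eq_bigr => k _; rewrite valK.
  have h0 : h != 0.
    apply/eqP => /(congr1 (fun p : {poly K} => p`_t)); rewrite coef0 hE coef_poly ltn_ord valK.
    by apply/eqP; case: (be_spec a').
  have szh : (size h <= t.+1)%N.
    apply/leq_sizeP => j tj; rewrite hE coef_poly; case: ltnP => // jN.
    rewrite insubT /=; rewrite /hasse big1 // => g _.
    have [->|cg] := eqVneq (c (fcons (Ordinal jN) g)) 0; first by rewrite mul0r.
    have /tmax /= : [exists g, c (fcons (Ordinal jN) g) != 0] by apply/existsP; exists g.
    by rewrite leqNgt tj.
  (* A derivative of order [mu] lowers each multiplicity by at most [mu]; truncated subtraction
     covers the weights below [mu]. *)
  have dv a : ('X - (s a)%:P) ^+ (w (fcons a a') - mu) %| h.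
    apply: dvdp_of_vanishing => i lt.
    rewrite -[RHS](van (fcons a a') (fcons i (be a'))); last by rewrite sum_fcons addnC -ltn_subRL.
    rewrite hasse_fcons; apply: eq_bigr => k _; rewrite !fcons0; congr (_ * _).
    by apply: eq_hasse => // j /=; rewrite fconsS.
  have := sum_multiplicity sI h0 dv => le.
  have : (\sum_a (w (fcons a a') - mu) <= t)%N.
    by apply: (leq_trans le); rewrite -ltnS prednK // size_poly_gt0.
  rewrite -sum_nat_const addnC => le'.
  apply: leq_trans (leq_add (leqnn _) le'); rewrite -big_split /=.
  by apply: leq_sum => a _; rewrite -leq_subLR.
rewrite big_fcons exchange_big /=.
have : (\sum_(a' : {ffun 'I_n -> I}) \sum_a w (fcons a a') <=
        \sum_(a' : {ffun 'I_n -> I}) (t + #|I| * \sum_i be a' i))%N.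
  by apply: leq_sum => a' _; apply: fiber.
rewrite big_split /= sum_nat_const card_ffun card_ord -big_distrr /= => le.
apply: leq_trans (leq_mul (leqnn _) le) _.
rewrite mulnDr; apply: leq_trans (leq_add (leqnn _) (leq_mul (leqnn #|I|) IH)) _.
by rewrite -mulnDr [(_ * t)%N]mulnC -mulnDl subnKC // expnS mulnCA.
Qed.

(** * A Kakeya theorem for planes *)

Lemma card_bounded_degree m d :
  #|[set al : {ffun 'I_m -> 'I_d.+1} | (\sum_i al i <= d)%N]| = 'C(m + d, m).
Proof.
rewrite -card_partial_ord_partitions.
pose f (al : {ffun 'I_m -> 'I_d.+1}) := [tuple al i | i < m].
have fbij : bijective f.
  exists (fun t => [ffun i => tnth t i]) => [al|t].
    by apply/ffunP => i; rewrite ffunE tnth_mktuple.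
  by apply: eq_from_tnth => i; rewrite tnth_mktuple ffunE.
rewrite -(on_card_preimset (onW_bij _ fbij)); apply: eq_card => al.
by rewrite !inE big_tuple; congr (_ <= _)%N; apply: eq_bigr => i _; rewrite tnth_mktuple.
Qed.

(** Pigeonhole: there are more polynomials of degree at most [D] than value tables for the
    prescribed derivatives, so two of them share a table and their difference serves. *)
Lemma interpolation_multiplicity (F : finFieldType) m (T : {set 'rV[F]_m}) D M :
  (#|T| * 'C(m + M, m) < 'C(m + D, m))%N ->
  exists c : {ffun 'I_m -> 'I_D.+1} -> F,
    [/\ exists al, c al != 0, forall al, c al != 0 -> (\sum_i al i <= D)%N &
        forall x b, x \in T -> (\sum_i b i <= M)%N -> hasse c b (x 0) = 0].
Proof.
move=> lt; set A := [set al : {ffun 'I_m -> 'I_D.+1} | (\sum_i al i <= D)%N].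
set B := [set b : {ffun 'I_m -> 'I_M.+1} | (\sum_i b i <= M)%N].
pose J : finType := ({x | x \in T} * {b | b \in B})%type.
pose Phi (c : {ffun {ffun 'I_m -> 'I_D.+1} -> F}) : {ffun J -> F} :=
  [ffun j : J => hasse c (fun i => val j.2 i) (val j.1 0)].
have /dinjectivePn[c1 c1P [c2 /andP[c21 c2P] eqPhi]] : ~~ dinjectiveb Phi (pffun_on 0 A predT).
  apply/negP => /dinjectiveP /card_in_image cardE.
  have := max_card (mem (image Phi (pffun_on 0 A predT))).
  rewrite cardE card_pffun_on card_ffun leqNgt card_prod !card_sig; case/negP.
  by rewrite ltn_exp2l ?finNzRing_gt1 // (card_bounded_degree m D) (card_bounded_degree m M).
have supp (c : {ffun {ffun 'I_m -> 'I_D.+1} -> F}) al : c \in pffun_on 0 A predT -> c al != 0 -> (\sum_i al i <= D)%N.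
  by case/pffun_onP => /supportP sA _ cal; apply: contraTT cal => nA; rewrite sA ?inE ?eqxx.
exists (fun al => c1 al - c2 al); split.
- have /existsP[al] : [exists al, c1 al != c2 al].
    apply: contraNT c21 => /existsPn e; apply/eqP/ffunP => al.
    by apply/esym/eqP/negPn/e.
  by exists al; rewrite subr_eq0.
- move=> al; have [e|/(supp _ _ c1P)//] := eqVneq (c1 al) 0.
  by rewrite e sub0r oppr_eq0 => /(supp _ _ c2P).
- move=> x b xT bM.
  have bB i : (b i < M.+1)%N.
    by rewrite ltnS (leq_trans _ bM) // (bigD1 i) //= leq_addr.
  pose b' : {ffun 'I_m -> 'I_M.+1} := [ffun i => Ordinal (bB i)].
  have b'B : b' \in B.
    by rewrite inE; under eq_bigr do rewrite ffunE /=.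
  have := congr1 (fun g : {ffun J -> F} => g (Sub x xT, Sub b' b'B)) eqPhi.
  rewrite !ffunE /= => e.
  have eb : b =1 (fun i => b' i) by move=> i; rewrite ffunE.
  rewrite (eq_hasse (fun _ => erefl) eb (fun _ => erefl)).
  transitivity (hasse c1 (fun i => b' i) (x 0) - hasse c2 (fun i => b' i) (x 0)).
    by rewrite /hasse -sumrB; apply: eq_bigr => al _; rewrite mulrBl.
  by rewrite e subrr.
Qed.

(** [d] only bounds the degrees: the coefficient at the nominal top is still multiplicative, both
    sides vanishing when some degree drops. *)
Lemma prod_poly_top (R : comNzRingType) (I : finType) (p : I -> {poly R}) (d : I -> nat) :
  (forall i, (size (p i) <= (d i).+1)%N) ->
  (size (\prod_i p i)%R <= (\sum_i d i).+1)%N /\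
  (\prod_i p i)`_(\sum_i d i)%N = \prod_i (p i)`_(d i).
Proof.
move=> szp; pose P (u : {poly R}) (e : nat) (a : R) := (size u <= e.+1)%N /\ u`_e = a.
apply: (big_rec3 P); first by rewrite /P size_poly1 coef1.
move=> i u e a _ [szu ua]; split.
  apply: leq_trans (size_polyMleq _ _) _.
  by have := szp i; move: szu; lia.
have lt : (d i < (d i + e).+1)%N by lia.
rewrite coefM (bigD1 (Ordinal lt)) //= addKn ua big1 ?addr0 // => j nj.
have [ij|ji] := ltnP (d i) j.
  by rewrite [(p i)`_j]nth_default ?mul0r // (leq_trans (szp i)).
rewrite [u`_(_)]nth_default ?mulr0 // (leq_trans szu) //.
have : nat_of_ord j != d i by apply: contra nj => /eqP e'; apply/eqP/val_inj.
by lia.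
Qed.

Lemma prod_hasse_eq0 (A : comNzRingType) m (a b : 'I_m -> nat) (x : 'I_m -> A) :
  ~~ [forall i, b i <= a i]%N ->
  \prod_i (x i ^+ (a i - b i) *+ 'C(a i, b i)) = 0.
Proof.
case/forallPn => i; rewrite -ltnNge => lt.
by rewrite (bigD1 i) //= bin_small // mulr0n mul0r.
Qed.

(** * Restriction of a polynomial to a polynomial curve *)

Section Restriction.
Variables (K : fieldType) (m N : nat) (c : {ffun 'I_m -> 'I_N} -> K) (D q : nat).
Variable (x : 'I_m -> {poly K}).
Hypothesis degc : forall al, c al != 0 -> (\sum_i al i <= D)%N.
Hypothesis q_gt0 : (0 < q)%N.
Hypothesis szx : forall i, (size (x i) <= q.+1)%N.

Let topc (al : {ffun 'I_m -> 'I_N}) : K := if (\sum_i al i == D)%N then c al else 0.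

(** Each [x i] has degree at most [q], so only monomials of total degree [D] reach the top
    coefficient, and they see only the coefficients of [x] at [q]. *)
Lemma hasse_poly_top b : (\sum_i b i <= D)%N ->
  (size (hasse (polyC \o c) b x) <= ((D - \sum_i b i) * q).+1)%N /\
  (hasse (polyC \o c) b x)`_((D - \sum_i b i) * q) = hasse topc b (fun i => (x i)`_q).
Proof.
move=> bD; set e := ((D - _) * q)%N.
pose P (u : {poly K}) (a : K) := (size u <= e.+1)%N /\ u`_e = a.
apply: (big_ind2 P); first by rewrite /P size_poly0 coef0.
  move=> u a v d [su ua] [sv vd]; split; last by rewrite coefD ua vd.
  by rewrite (leq_trans (size_polyD _ _)) // geq_max su.
move=> al _; rewrite /P /topc /=.
have [le|] := boolP [forall i, (b i <= al i)%N]; last first.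
  by move=> nle; rewrite !prod_hasse_eq0 // !mulr0 size_poly0 coef0.
have {}le i : (b i <= al i)%N by apply/forallP: i.
have sumE : (\sum_i (al i - b i) = \sum_i al i - \sum_i b i)%N by rewrite sumnB.
have [] := @prod_poly_top K 'I_m (fun i => x i ^+ (al i - b i) *+ 'C(al i, b i))
             (fun i => (al i - b i) * q)%N.
  move=> i; rewrite -mulr_natr mulrC -polyC_natr mul_polyC.
  apply: leq_trans (size_scale_leq _ _) _.
  have := @prod_poly_top K 'I_(al i - b i) (fun=> x i) (fun=> q) (fun=> szx i).
  by rewrite prodr_const sum_nat_const card_ord => -[].
rewrite -big_distrl /= sumE => sz cf.
have [->|cal] := eqVneq (c al) 0.
  by rewrite polyC0 mul0r size_poly0 coef0; split=> //; case: ifP; rewrite mul0r.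
have alD := degc cal.
split.
  rewrite mul_polyC (leq_trans (size_scale_leq _ _)) // (leq_trans sz) //.
  by rewrite ltnS leq_mul2r leq_sub2r ?orbT.
rewrite mul_polyC coefZ; case: eqVneq => [eD|neD].
  rewrite /e -eD cf; congr (_ * _); apply: eq_bigr => i _.
  rewrite coefMn; congr (_ *+ _).
  have := @prod_poly_top K 'I_(al i - b i) (fun=> x i) (fun=> q) (fun=> szx i).
  by rewrite !prodr_const sum_nat_const card_ord => -[].
have altD : (\sum_i al i < D)%N by rewrite ltn_neqAle neD.
rewrite mul0r nth_default ?mulr0 // (leq_trans sz) // /e ltn_mul2r q_gt0 /=.
by rewrite ltn_sub2r // (leq_ltn_trans _ altD) // leq_sum.
Qed.

(** Write [x] as its value at [theta] plus a multiple of ['X - theta] and apply the Taylor formula.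
    Each term either contains a derivative of total order below [M], which vanishes, or has enough
    factors ['X - theta]. *)
Lemma dvdp_hasse_poly (theta : K) (M : nat) b :
  (forall b', (\sum_i b' i < M)%N -> hasse c b' (fun i => (x i).[theta]) = 0) ->
  ('X - theta%:P) ^+ (M - \sum_i b i) %| hasse (polyC \o c) b x.
Proof.
move=> van.
pose v i := ((x i - ((x i).[theta])%:P) %/ ('X - theta%:P)) * ('X - theta%:P).
have vE i : ((x i).[theta])%:P + v i = x i.
  rewrite /v divpK; first by rewrite addrC subrK.
  by rewrite dvdp_XsubCl /root !hornerE subrr.
rewrite -(eq_hasse (fun _ => erefl) (fun _ => erefl) vE) hasse_taylor.
apply: (big_ind (fun p => _ %| p)) => [|u w|g _]; [exact: dvdp0|exact: dvdp_add|].
have [lt|le] := ltnP (\sum_i (b i + g i)) M.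
  by rewrite -(rmorph_hasse polyC) van // rmorph0 mul0r dvdp0.
rewrite dvdp_mull //.
have -> : \prod_i (v i ^+ g i *+ 'C(b i + g i, b i)) =
    (\prod_i (((x i - ((x i).[theta])%:P) %/ ('X - theta%:P)) ^+ g i *+ 'C(b i + g i, b i)))
    * ('X - theta%:P) ^+ (\sum_i g i).
  rewrite expr_sum -big_split /=; apply: eq_bigr => i _.
  by rewrite exprMn mulrnAl.
by rewrite dvdp_mull // dvdp_exp2l // leq_subLR -big_split.
Qed.

(** The points of [G] give more roots, counted with multiplicity, than the degree allows. So the
    restricted derivative is zero, and so is its top coefficient. *)
Lemma hasse_top_eq0 (I : finType) (theta : I -> K) (M : nat) b (G : {set I}) :
  injective theta ->
  (forall t b', t \in G -> (\sum_i b' i < M)%N ->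
     hasse c b' (fun i => (x i).[theta t]) = 0) ->
  ((D - \sum_i b i) * q < (M - \sum_i b i) * #|G|)%N ->
  hasse topc b (fun i => (x i)`_q) = 0.
Proof.
move=> thI van lt.
have [bD|Db] := leqP (\sum_i b i) D; last first.
  rewrite /hasse big1 // => al _; rewrite /topc.
  case: eqVneq => [eD|]; last by rewrite mul0r.
  have [|] := boolP [forall i, b i <= al i]%N.
    move=> /forallP le; move: Db; rewrite -eD ltnNge => /negP[].
    exact: leq_sum.
  by move=> nle; rewrite prod_hasse_eq0 // mulr0.
have [sz <-] := hasse_poly_top bD.
suff -> : hasse (polyC \o c) b x = 0 by rewrite coef0.
apply/eqP/negPn/negP => V0.
have := @sum_multiplicity K I theta (fun t => if t \in G then (M - \sum_i b i)%N else 0%N) _ thI V0.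
rewrite -big_mkcond /= sum_nat_const => le; have {}le := le _.
have /le : forall t, ('X - (theta t)%:P) ^+ (if t \in G then (M - \sum_i b i)%N else 0%N)
    %| hasse (polyC \o c) b x.
  move=> t; case: ifP => [tG|_]; last by rewrite expr0 dvd1p.
  by apply: dvdp_hasse_poly => b' ?; apply: van.
apply/negP; rewrite -ltnNge mulnC; apply: leq_ltn_trans lt.
by rewrite -ltnS prednK // size_poly_gt0.
Qed.

End Restriction.

Lemma frobenius_card (F : finFieldType) (K : fieldType) (f : {rmorphism F -> K}) (u v : K) :
  (u + v) ^+ #|F| = u ^+ #|F| + v ^+ #|F|.
Proof.
have [p p_pr pF] := finPcharP F.
have cardF : #|F| = (p ^ logn p #|F|)%N := card_pprimeChar pF.
have pK := rmorph_pchar f pF.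
by rewrite cardF; apply: exprDn_pchar; rewrite pnatX pnatE ?pK.
Qed.

(** A transcendental [z] works: in the rational functions over [F], the elements 1 and ['X] are
    independent over [F], and ['X] is not its own power of exponent [#|F|]. *)
Lemma exists_quadratic_parameter (F : finFieldType) :
  exists (K : fieldType) (f : {rmorphism F -> K}) (z : K),
    (forall x y, f x + z * f y = 0 -> x = 0 /\ y = 0) /\ z ^+ #|F| != z.
Proof.
pose f : {rmorphism F -> {fraction {poly F}}} := (@tofrac {poly F} \o polyC).
exists {fraction {poly F}}, f, (@tofrac {poly F} 'X); split.
  move=> x y; rewrite /f /= -rmorphM -rmorphD => /eqP; rewrite tofrac_eq0 => /eqP e.
  split; first by have := congr1 (coefp 0) e; rewrite /= !coefE /= mul0r addr0.
  by have := congr1 (coefp 1) e; rewrite /= !coefE /= mul1r add0r.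
rewrite -rmorphXn -subr_eq0 -rmorphB tofrac_eq0 subr_eq0.
apply/eqP => /(congr1 (fun p : {poly F} => size p)); rewrite size_polyXn size_polyX.
by move=> [qE]; have := finNzRing_gt1 F; rewrite qE.
Qed.

Section KakeyaPlanes.
Variables (F : finFieldType) (m : nat) (T : {set 'rV[F]_m}) (X : {set 'M[F]_(2, m)}).
Let q := #|F|.

(** [D] bounds the degree of the interpolating polynomial, whose derivatives of order below [M]
    vanish on [T]. A rich plane has at least [g] points in [T], which forces the derivatives of
    order below [w] to vanish on it. The last hypothesis contradicts Schwartz-Zippel for the top
    part. *)
Theorem kakeya_planes (D M w g : nat) :
  (forall b, b \in X -> exists a : 'rV_m, (g <= #|[set t : 'rV_2 | (a + t *m b)%R \in T]|)%N) ->
  (0 < g)%N -> (w <= M)%N -> (D * q <= (M - w) * g)%N ->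
  (D * q ^ (2 * m) < q ^ 2 * (w * #|X|))%N ->
  ('C(m + D, m) <= #|T| * 'C(m + M.-1, m))%N.
Proof.
move=> rich g0 wM hg hX; rewrite leqNgt; apply/negP => /interpolation_multiplicity.
case=> c [[al0 cal0] degc van].
have [K [f [z [fz zq]]]] := exists_quadratic_parameter F.
set om := z ^+ q - z; have om0 : om != 0 by rewrite subr_eq0.
(* The top part is taken at the true degree [D0], possibly below [D], so that it is nonzero. *)
case: (@arg_maxnP _ al0 (fun al => c al != 0) (fun al => \sum_i al i)%N cal0) => al cal amax.
set D0 := (\sum_i al i)%N; have D0D : (D0 <= D)%N := degc al cal.
pose fc be := f (c be).
pose topc (be : {ffun 'I_m -> 'I_D.+1}) : K := if (\sum_i be i == D0)%N then fc be else 0.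
(* Encodes a column of a direction matrix as one element of [K]; its values form the side, of size
   [q ^ 2], of the grid. *)
pose s (u : 'cV[F]_2) : K := (f (u 1 0) - z * f (u 0 0)) / om.
have sI : injective s.
  move=> u v /(mulIf (invr_neq0 om0)) e.
  have [e1 e0] : u 1 0 - v 1 0 = 0 /\ v 0 0 - u 0 0 = 0.
    by apply: fz; rewrite !rmorphB mulrBr; move/eqP: e; rewrite -subr_eq0 => /eqP <-; ring.
  apply/colP => i; case: (unliftP 0 i) => [j ->|->].
    have -> : lift 0 j = 1 by rewrite (ord1 j); apply/val_inj.
    by apply/eqP; rewrite -subr_eq0 e1.
  by apply/eqP; rewrite eq_sym -subr_eq0 e0.
(* tau = t_1 + z t_2 parametrizes the plane; since t_1, t_2 are fixed by the q-th power,
   they are the polynomials tau - z l2 and l2 in tau. *)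
pose th (t : 'rV[F]_2) : K := f (t 0 0) + z * f (t 0 1).
have thI : injective th.
  move=> u v e.
  have [e0 e1] : u 0 0 - v 0 0 = 0 /\ u 0 1 - v 0 1 = 0.
    apply: fz; rewrite !rmorphB mulrBr; move/eqP: e; rewrite -subr_eq0 => /eqP <-.
    by rewrite /th; ring.
  apply/rowP => i; case: (unliftP 0 i) => [j ->|->].
    have -> : lift 0 j = 1 by rewrite (ord1 j); apply/val_inj.
    by apply/eqP; rewrite -subr_eq0 e1.
  by apply/eqP; rewrite -subr_eq0 e0.
pose l2 : {poly K} := om^-1 *: ('X^q - 'X).
have l2E t : l2.[th t] = f (t 0 1).
  rewrite /l2 !hornerE /th (frobenius_card f) exprMn -!rmorphXn !expf_card.
  apply: (mulfI om0); rewrite mulrA divff // mul1r /om -/q; ring.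
pose l1 : {poly K} := 'X - z *: l2.
have l1E t : l1.[th t] = f (t 0 0).
  by rewrite /l1 hornerD hornerN hornerZ l2E hornerX /th addrK.
have q1 : (1 < q)%N := finNzRing_gt1 F.
have szl2 : (size l2 <= q.+1)%N.
  apply: leq_trans (size_scale_leq _ _) _; apply: leq_trans (size_polyD _ _) _.
  by rewrite geq_max size_polyXn leqnn size_polyN size_polyX; lia.
have szl1 : (size l1 <= q.+1)%N.
  apply: leq_trans (size_polyD _ _) _; rewrite geq_max size_polyX size_polyN.
  by rewrite (leq_trans (size_scale_leq _ _)) // andbT; lia.
have l2q : l2`_q = om^-1.
  by rewrite /l2 coefZ coefB coefXn coefX eqxx gtn_eqF // subr0 mulr1.
have l1q : l1`_q = - z / om.
  by rewrite /l1 coefB coefX coefZ l2q gtn_eqF // sub0r mulNr.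
have topE (a : {ffun 'I_m -> 'cV[F]_2}) (b : {ffun 'I_m -> 'I_D.+1}) :
    (\matrix_(i, j) a j i 0) \in X -> (\sum_i b i < w)%N ->
    hasse topc (fun i => b i) (fun i => s (a i)) = 0.
  move=> aX bw; have [p0 gG] := rich _ aX.
  set G := [set t | _] in gG.
  (* The plane through [p0] as a curve of degree at most [q] in tau; its coefficient at [q] is the
     grid point of the direction. *)
  pose x i := (f (p0 0 i))%:P + f (a i 0 0) *: l1 + f (a i 1 0) *: l2.
  have szx i : (size (x i) <= q.+1)%N.
    apply: leq_trans (size_polyD _ _) _; rewrite geq_max (leq_trans (size_scale_leq _ _)) //.
    rewrite andbT (leq_trans (size_polyD _ _)) // geq_max (leq_trans (size_scale_leq _ _)) //.
    by rewrite andbT (leq_trans (size_polyC_leq1 _)).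
  have xq i : (x i)`_q = s (a i).
    rewrite /x 2!coefD coefC !(coefZ (f _)) l1q l2q gtn_eqF ?(ltnW q1) // /s; field.
    exact: om0.
  have dfc be : fc be != 0 -> (\sum_i be i <= D0)%N.
    by rewrite fmorph_eq0 => /amax.
  rewrite -(eq_hasse (fun _ => erefl) (fun _ => erefl) xq).
  apply: (@hasse_top_eq0 _ _ _ fc D0 q x dfc _ szx _ th M (fun i => b i) G thI); first exact: ltnW.
    move=> t b'; rewrite inE => tG b'M.
    have xE i : (x i).[th t] = f ((p0 + t *m (\matrix_(i, j) a j i 0)) 0 i).
      rewrite /x 2!hornerD hornerC !(hornerZ (f _)) l1E l2E !mxE rmorphD big_ord_recl big_ord1 !mxE rmorphD !rmorphM.
      rewrite addrA; congr (_ + _ + _); rewrite mulrC //.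
      by have -> : lift 0 0 = 1 :> 'I_2 by apply/val_inj.
    rewrite (eq_hasse (fun _ => erefl) (fun _ => erefl) xE) -(rmorph_hasse f) van ?rmorph0 //.
    by lia.
  have : ((D0 - \sum_i b i) * q <= D * q)%N by rewrite leq_mul2r; apply/orP; right; lia.
  move=> le; apply: (leq_ltn_trans le); apply: (leq_ltn_trans hg).
  apply: (@leq_trans ((M - \sum_i b i) * g)); last by rewrite leq_mul2l gG orbT.
  by rewrite ltn_mul2r g0; lia.
pose wt (a : {ffun 'I_m -> 'cV[F]_2}) := if (\matrix_(i, j) a j i 0) \in X then w else 0%N.
have [] : (exists be, topc be != 0) /\ (forall be, topc be != 0 -> (\sum_i be i <= D0)%N).
  split; first by exists al; rewrite /topc eqxx fmorph_eq0.
  by move=> be; rewrite /topc; case: ifP => [/eqP ->|_] //; rewrite eqxx.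
move=> /(schwartz_zippel_multiplicity sI) sz /sz{}sz.
have := sz wt; have -> : (\sum_a wt a = w * #|X|)%N.
  rewrite /wt -big_mkcond /= sum_nat_const mulnC; congr muln.
  pose h (a : {ffun 'I_m -> 'cV[F]_2}) : 'M[F]_(2, m) := \matrix_(i, j) a j i 0.
  have hbij : bijective h.
    exists (fun b => [ffun j => col j b]) => [a|b].
      by apply/ffunP => j; rewrite ffunE; apply/colP => i; rewrite !mxE.
    by apply/matrixP => i j; rewrite !mxE ffunE mxE.
  by rewrite -(on_card_preimset (onW_bij _ hbij)); apply: eq_card => a; rewrite !inE.
rewrite card_mx muln1 -expnM => le.
suff : (q ^ 2 * (w * #|X|) <= D0 * q ^ (2 * m))%N.
  by rewrite leqNgt (leq_ltn_trans _ hX) // leq_mul2r D0D orbT.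
apply: le => a b; rewrite /wt; case: ifP => [aX|]; last by rewrite ltn0.
exact: topE.
Qed.
End KakeyaPlanes.

(** Bernoulli in the form (a / (a + 1))^k >= 1 - k / (a + 1), at a = 2m and k = m. *)
Lemma expn_succ_le2 m : ((2 * m).+1 ^ m <= 2 * (2 * m) ^ m)%N.
Proof.
have bernoulli a k : (k <= a -> a.+1 ^ k * (a.+1 - k) <= a ^ k * a.+1)%N.
  elim: k => [|k IH] ka; first by rewrite !expn0 subn0.
  have {IH} := IH (ltnW ka); rewrite !expnS.
  set u := (a.+1 ^ k)%N; set v := (a ^ k)%N => IH.
  have -> : (a.+1 - k.+1 = a - k)%N by lia.
  have e : (a.+1 * (a - k) <= a * (a.+1 - k))%N by nia.
  have := leq_mul (leqnn u) e; have := leq_mul (leqnn a) IH; lia.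
have := bernoulli (2 * m)%N m; rewrite leq_pmull // => /(_ isT).
have -> : ((2 * m).+1 - m = m.+1)%N by lia.
set u := ((2 * m).+1 ^ m)%N; set v := ((2 * m) ^ m)%N => le.
by rewrite -(leq_pmul2r (ltn0Sn m)); nia.
Qed.

(** With D = m q^2, the quotient of the two binomials is at least (D / (m + M - 1))^m >= (2 m q / (2
    m + 1))^m >= q^m / 2. *)
Corollary kakeya_planes_half (F : finFieldType) (m : nat) (T : {set 'rV[F]_m})
    (X : {set 'M[F]_(2, m)}) :
  (0 < m)%N -> (28 * m <= #|F|)%N ->
  (forall b, b \in X -> exists a : 'rV_m,
     (8 * m * #|[set t : 'rV_2 | (a + t *m b)%R \notin T]| <= #|F| ^ 2)%N) ->
  (#|F| ^ (2 * m) <= 4 * #|X|)%N ->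
  (#|F| ^ m <= 2 * #|T|)%N.
Proof.
move=> m0 qm rich hX; set q := #|F| in qm rich hX *.
have q1 : (1 < q)%N := finNzRing_gt1 F.
have X0 : (0 < #|X|)%N by have : (0 < q ^ (2 * m))%N; [rewrite expn_gt0; lia | lia].
pose r := (q ^ 2 %/ (8 * m))%N.
have r8 : (8 * m * r <= q ^ 2)%N by rewrite mulnC leq_divM.
have q2 : (0 < q ^ 2)%N by rewrite expn_gt0; lia.
(* The factor 5 in [w] beats the density 1/4 of [X]. The excess q/7 in [M - w] compensates the
   missing part [r] of a plane, since (7m + 1)(8m - 1) >= 56 m^2. *)
pose g := (q ^ 2 - r)%N; pose w := (5 * m)%N; pose M := (w + (m * q + (q %/ 7).+1))%N.
have g0 : (0 < g)%N by rewrite subn_gt0; nia.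
have hg : (m * q ^ 2 * q <= (M - w) * g)%N.
  rewrite /M addKn.
  have g8 : ((8 * m - 1) * q ^ 2 <= 8 * m * g)%N by rewrite /g; nia.
  have q7 : ((7 * m + 1) * q <= 7 * (m * q + (q %/ 7).+1))%N by lia.
  have mm : (m * q * (8 * m) * 7 <= (8 * m - 1) * ((7 * m + 1) * q))%N by nia.
  rewrite -(leq_pmul2l (_ : 0 < 7 * (8 * m))%N); last by lia.
  have := leq_mul q7 g8; have := leq_mul mm (leqnn (q ^ 2)).
  set Q := (q ^ 2)%N; set G := (_ + _.+1)%N => l1 l2; lia.
have richg b : b \in X -> exists a : 'rV_m, (g <= #|[set t : 'rV_2 | (a + t *m b)%R \in T]|)%N.
  move=> /rich[a ha]; exists a.
  have := cardsC [set t : 'rV_2 | (a + t *m b)%R \in T].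
  rewrite card_mx mul1n -/q => e; rewrite leq_subLR -{}e addnC leq_add2r.
  rewrite leq_divRL; last by lia.
  rewrite mulnC; apply: leq_trans ha; rewrite leq_mul2l subset_leq_card ?orbT //.
  by apply/subsetP => t; rewrite !inE.
have hX' : (m * q ^ 2 * q ^ (2 * m) < q ^ 2 * (w * #|X|))%N.
  rewrite /w -mulnA mulnCA ltn_pmul2l //; nia.
have := kakeya_planes richg g0 (leq_addr _ _) hg hX'.
rewrite -(leq_pmul2r (fact_gt0 m)) -[X in (_ <= X)%N]mulnA !bin_ffact !ffact_prod => le.
have l1 : ((m * q ^ 2) ^ m <= \prod_(i < m) (m + m * q ^ 2 - i))%N.
  rewrite -[X in (_ ^ X <= _)%N](card_ord m) -prod_nat_const; apply: leq_prod => i _.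
  by have := ltn_ord i; lia.
have l2 : (\prod_(i < m) (m + M.-1 - i) <= (m + M.-1) ^ m)%N.
  rewrite -[X in (_ <= _ ^ X)%N](card_ord m) -prod_nat_const; apply: leq_prod => i _.
  exact: leq_subr.
(* Here [28 * m <= q] absorbs the terms 12m + 2q/7 into a single q. *)
have l3 : (2 * (m + M.-1) <= q * (2 * m).+1)%N.
  rewrite /M /w !addnS /= mulnS; have := leq_divM q 7; have := mulnCA q 2 m.
  move: qm; move: (q * (2 * m))%N (m * q)%N (q %/ 7)%N (mulnC m q) => u v d.
  by move: (q * m)%N => v'; clear; lia.
have l4 : ((2 * m * (q * q)) ^ m <= #|T| * (q * (2 * m).+1) ^ m)%N.
  apply: leq_trans (_ : #|T| * (2 * (m + M.-1)) ^ m <= _)%N; last first.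
    by rewrite leq_mul2l leq_exp2r ?l3 ?orbT.
  rewrite -mulnn in l1; rewrite -[(2 * m * _)%N]mulnA !expnMn [(#|T| * _)%N]mulnCA leq_mul2l.
  apply/orP; right; rewrite -(expnMn q q m) -(expnMn m (q * q) m).
  by apply: (leq_trans l1); rewrite -mulnn in le; apply: (leq_trans le); rewrite leq_mul2l l2 orbT.
have l5 := expn_succ_le2 m.
move: l4; rewrite (expnMn (2 * m)) (expnMn q q) (expnMn q (2 * m).+1).
rewrite [(#|T| * _)%N]mulnCA mulnCA leq_pmul2l ?expn_gt0 ?(ltnW q1) // => l4.
have mm0 : (0 < (2 * m) ^ m)%N by rewrite expn_gt0 muln_gt0 m0.
rewrite -(leq_pmul2l mm0); apply: (leq_trans l4).
by apply: leq_trans (leq_mul (leqnn _) l5) _; rewrite mulnCA mulnA mulnC.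
Qed.

(** * Random linear hashing *)

Section LinearHashing.
Variables (R : realFieldType) (F : finFieldType).
Let q : R := #|F|%:R.

(** The map sending [E] to [v *m E] is onto, and its fibres are translates of its kernel. *)
Lemma card_mx_annihilating n r (v : 'rV[F]_n) : v != 0 ->
  (#|[set E : 'M[F]_(n, r) | (v *m E == 0)%R]| * #|F| ^ r = #|F| ^ (n * r))%N.
Proof.
case/rV0Pn => i vi0.
rewrite -[RHS]card_mx -[RHS]sum1_card (partition_big (fun E : 'M[F]_(n, r) => v *m E) predT) //=.
rewrite -[r in (_ ^ r)%N]mul1n -card_mx mulnC -sum_nat_const; apply: eq_bigr => e _.
rewrite sum1dep_card.
pose E0 : 'M[F]_(n, r) := (v 0 i)^-1 *: (delta_mx i 0 *m e).
have vE0 : v *m E0 = e.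
  rewrite -scalemxAr mulmxA -colE [col i v]mx11_scalar mxE mul_scalar_mx.
  by rewrite scalerA mulVf ?scale1r.
transitivity #|[set E + E0 | E in [set E : 'M[F]_(n, r) | v *m E == 0]]|.
  by rewrite card_imset //; apply: addIr.
apply: eq_card => E; rewrite [RHS]inE.
apply/imsetP/eqP => [[E' /[!inE] /eqP vE' ->]|vE].
  by rewrite mulmxDr vE' add0r.
by exists (E - E0); rewrite ?subrK // inE mulmxBr vE vE0 subrr.
Qed.

Definition hash_fiber n r (S : {set 'rV[F]_n}) (E : 'M[F]_(n, r)) (e : 'rV[F]_r) :=
  [set x in S | x *m E == e].

(** The variance counts colliding pairs. Distinct points collide with probability q^-r, which
    cancels against the squared mean; the diagonal leaves [#|S|]. *)
Lemma hash_second_moment n r (S : {set 'rV[F]_n}) :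
  \sum_(E : 'M[F]_(n, r)) \sum_(e : 'rV[F]_r)
     (#|hash_fiber S E e|%:R - #|S|%:R / q ^+ r) ^+ 2
  <= q ^+ (n * r) * #|S|%:R.
Proof.
have q0 : q != 0 by rewrite pnatr_eq0 -lt0n (ltnW (finNzRing_gt1 F)).
have qr0 : q ^+ r != 0 by rewrite expf_neq0.
set mu := _ / _.
have sumf (E : 'M[F]_(n, r)) : \sum_e #|hash_fiber S E e|%:R = #|S|%:R :> R.
  rewrite -natr_sum -[in RHS]sum1_card (partition_big (fun x => x *m E) predT) //=.
  by congr (_%:R); apply: eq_bigr => e _; rewrite sum1dep_card /hash_fiber; apply: eq_card => x; rewrite !inE.
have sqf (E : 'M[F]_(n, r)) : \sum_e #|hash_fiber S E e|%:R ^+ 2 =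
    \sum_(x in S) \sum_(y in S) ((x - y) *m E == 0)%:R :> R.
  have fE e : #|hash_fiber S E e|%:R = \sum_(x in S) (x *m E == e)%:R :> R.
    by rewrite /hash_fiber -sum1dep_card natr_sum big_mkcondr /=; apply: eq_bigr => x _; case: eqP.
  under eq_bigr do rewrite fE expr2 big_distrlr /=.
  rewrite exchange_big /=; apply: eq_bigr => x _.
  rewrite exchange_big /=; apply: eq_bigr => y _.
  rewrite (bigD1 (x *m E)) //= eqxx mul1r big1 ?addr0; last first.
    by move=> e /negbTE; rewrite eq_sym => ->; rewrite mul0r.
  by rewrite mulmxBl subr_eq0 eq_sym.
have expand (E : 'M[F]_(n, r)) : \sum_e (#|hash_fiber S E e|%:R - mu) ^+ 2 =
    \sum_(x in S) \sum_(y in S) ((x - y) *m E == 0)%:R - mu * #|S|%:R.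
  under eq_bigr do rewrite sqrrB.
  rewrite big_split sumrB /= sqf sumr_const card_mx mul1n.
  rewrite sumrMnl -big_distrl /= sumf -[_ *+ (_ ^ _)]mulr_natr natrX -/q.
  have -> : mu ^+ 2 * q ^+ r = mu * #|S|%:R by rewrite expr2 -mulrA divfK.
  by ring.
under eq_bigr do rewrite expand.
rewrite sumrB sumr_const card_mx exchange_big /=.
have q_gt0 : 0 < q by rewrite ltr0n (ltnW (finNzRing_gt1 F)).
have pair_sum (x y : 'rV[F]_n) : \sum_(E : 'M[F]_(n, r)) ((x - y) *m E == 0)%:R <=
    (x == y)%:R * q ^+ (n * r) + q ^+ (n * r) / q ^+ r.
  rewrite -natr_sum -big_mkcond /= sum1dep_card.
  have [->|xy] := eqVneq x y.
    rewrite mul1r ler_wpDr ?divr_ge0 ?exprn_ge0 ?(ltW q_gt0) //.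
    by rewrite /q -natrX -card_mx ler_nat max_card.
  rewrite mul0r add0r ler_pdivlMr ?exprn_gt0 // /q -!natrX -natrM ler_nat.
  by rewrite card_mx_annihilating ?subr_eq0.
have diag x : x \in S -> \sum_(y in S) ((x == y)%:R * q ^+ (n * r)) = q ^+ (n * r).
  move=> xS; rewrite (bigD1 x) //= eqxx mul1r big1 ?addr0 // => y /andP[_].
  by rewrite eq_sym => /negbTE ->; rewrite mul0r.
under eq_bigr do rewrite exchange_big /=.
apply: (@le_trans _ _ (\sum_(x in S) (q ^+ (n * r) + #|S|%:R * (q ^+ (n * r) / q ^+ r))
           - mu * #|S|%:R *+ (#|F| ^ (n * r)))).
  rewrite lerD2r; apply: ler_sum => x xS; rewrite -[X in X + _](diag x xS).
  rewrite mulr_natl -sumr_const -big_split /=; apply: ler_sum => y _.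
  exact: pair_sum.
rewrite sumr_const -mulr_natr -[X in _ - X]mulr_natr natrX -/q /mu le_eqVlt; apply/orP; left.
by apply/eqP; field.
Qed.

Lemma hash_chebyshev n r (S : {set 'rV[F]_n}) (lam : R) : 0 <= lam ->
  lam ^+ 2 * \sum_(E : 'M[F]_(n, r))
     #|[set e | lam <= `| #|hash_fiber S E e|%:R - #|S|%:R / q ^+ r |]|%:R
  <= q ^+ (n * r) * #|S|%:R.
Proof.
move=> lam0; apply: le_trans (hash_second_moment r S).
rewrite big_distrr /=; apply: ler_sum => E _.
rewrite -sumr_const big_distrr big_mkcond /=; apply: ler_sum => e _.
rewrite inE; case: ifP => [le|_]; last exact: sqr_ge0.
by rewrite mulr1 -[X in _ <= X]real_normK ?num_real // lerXn2r ?nnegrE.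
Qed.

(** If the mean fibre size [mu] is at distance [u] from [e0], then a fibre of size near [e0] is at
    distance at least [u / 2] from [mu]. Chebyshev makes such fibres rare on average, and Markov
    makes them rare for half of the matrices. *)
Lemma unbalanced_hash_fibers n (S : {set 'rV[F]_n}) (e0 tau : R) (h : nat) :
  0 < e0 -> 0 < tau -> (8 * h)%:R * (1 + tau) <= tau ^+ 2 * e0 ->
  tau * e0 < `| #|S|%:R / q ^+ 2 - e0 | ->
  q ^+ (n * 2) <= 2 * #|[set E : 'M[F]_(n, 2) | (h *
    #|[set e | (`| #|hash_fiber S E e|%:R - e0 | <= tau / 2 * e0)%R]| <= #|F| ^ 2)%N]|%:R.
Proof.
move=> e0_gt0 tau0 large; set mu := _ / _ => dev; set u := `| _ | in dev.
have q_gt0 : 0 < q by rewrite ltr0n (ltnW (finNzRing_gt1 F)).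
set count := fun E : 'M[F]_(n, 2) =>
  #|[set e | `| #|hash_fiber S E e|%:R - e0 | <= tau / 2 * e0]|.
set G := [set E | _].
have u0 : 0 < u by apply: lt_trans dev; rewrite mulr_gt0.
have sum_count : (u / 2) ^+ 2 * \sum_E (count E)%:R <= q ^+ (n * 2) * #|S|%:R.
  apply: le_trans (hash_chebyshev 2 S (_ : 0 <= u / 2)); last by rewrite divr_ge0 ?ltW.
  rewrite ler_wpM2l ?sqr_ge0 //; apply: ler_sum => E _; rewrite ler_nat subset_leq_card //.
  apply/subsetP => e; rewrite !inE -/mu => le.
  have : u <= `|mu - #|hash_fiber S E e|%:R| + `| #|hash_fiber S E e|%:R - e0 |.
    by apply: le_trans (ler_normD _ _); rewrite addrA subrK.
  by rewrite distrC; move: le dev; lra.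
have mu_le : mu <= e0 + u.
  by have := ler_norm (mu - e0); rewrite -/u; lra.
(* Since (e0 + u) / u^2 decreases in [u], the worst case is u = tau e0, which is the hypothesis on
   [h]. *)
have key : (8 * h)%:R * mu <= u ^+ 2.
  have h0 : 0 <= (8 * h)%:R :> R by [].
  have h1 : (8 * h)%:R * mu <= (8 * h)%:R * (e0 + u) by rewrite ler_wpM2l.
  have h2 : (8 * h)%:R * (1 + tau) * (e0 + u) <= tau ^+ 2 * e0 * (e0 + u).
    by rewrite ler_wpM2r // addr_ge0 ?ltW.
  have h3 : tau ^+ 2 * e0 * (e0 + u) <= u ^+ 2 * (1 + tau).
    have d0 : 0 <= u - tau * e0 by rewrite subr_ge0 ltW.
    have p1 : 0 <= (u - tau * e0) * (u + tau * e0).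
      by rewrite mulr_ge0 // addr_ge0 ?mulr_ge0 // ltW.
    have p2 : 0 <= tau * u * (u - tau * e0) by rewrite !mulr_ge0 // ltW.
    by rewrite -subr_ge0; apply: le_trans (addr_ge0 p1 p2) _; rewrite le_eqVlt; apply/orP; left; apply/eqP; ring.
  have t1 : 0 < 1 + tau by lra.
  by rewrite -(ler_pM2r t1); nra.
have SE : #|S|%:R = mu * q ^+ 2 by rewrite /mu divfK // expf_neq0 // gt_eqF.
have bad_count : q ^+ 2 * #|~: G|%:R <= h%:R * \sum_E (count E)%:R.
  rewrite mulr_natr -sumr_const big_distrr big_mkcond /=; apply: ler_sum => E _.
  case: ifP => [|_]; last by rewrite -natrM.
  by rewrite !inE -ltnNge => lt; rewrite /q -natrX -natrM ler_nat ltnW.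
have cG : #|~: G|%:R = q ^+ (n * 2) - #|G|%:R.
  by rewrite /q -natrX -card_mx -(cardsC G) natrD addrC addKr.
have Q0 : 0 < q ^+ 2 by rewrite exprn_gt0.
have N0 : 0 <= q ^+ (n * 2) by rewrite exprn_ge0 // ltW.
have u20 : 0 < u ^+ 2 by rewrite exprn_gt0.
move: sum_count bad_count; rewrite SE cG; move: (\sum_E _) key => Sg.
set N := q ^+ (n * 2) in N0 *; set Q := q ^+ 2 in Q0 *; set U := u ^+ 2 in u20 * => key s1 s2.
have s1' : U * Sg <= 4 * N * mu * Q.
  have uE : (u / 2) ^+ 2 = U / 4 by rewrite /U; field.
  by move: s1; rewrite uE; lra.
have h0 : 0 <= h%:R :> R by [].
have s3 : U * (Q * (N - #|G|%:R)) <= U * (h%:R * Sg) by rewrite ler_pM2l.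
have s4 : U * (h%:R * Sg) <= h%:R * (4 * N * mu * Q).
  by rewrite mulrCA ler_wpM2l.
have s5 : 8 * h%:R * mu * (N * Q) <= U * (N * Q).
  by apply: ler_wpM2r; [apply: mulr_ge0 (ltW Q0) | move: key; rewrite natrM].
have s6 : U * Q * (2 * (N - #|G|%:R)) <= U * Q * N by nra.
by move: s6; rewrite ler_pM2l ?mulr_gt0 //; lra.
Qed.

End LinearHashing.

(** * Greedy covering *)

Lemma card_bigcup_le (I : Type) (B : finType) (s : seq I) (P : pred I) (X : I -> {set B}) :
  (#|\bigcup_(i <- s | P i) X i| <= \sum_(i <- s | P i) #|X i|)%N.
Proof.
apply: (big_ind2 (fun (A : {set B}) k => #|A| <= k)%N); rewrite ?cards0 // => A k A' k' le le'.
by apply: leq_trans (leq_card_setU A A') (leq_add le le').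
Qed.

Lemma in_bigcup_seq (I : Type) (B : finType) (s : seq I) (X : I -> {set B}) b :
  (b \in \bigcup_(i <- s) X i) = has (fun i => b \in X i) s.
Proof. by elim: s => [|i s IH]; rewrite ?big_nil ?big_cons inE //= IH. Qed.

(** A random [w] shrinks the uncovered set by the factor [1 - x] on average. Choosing each [w] by
    averaging one combined potential controls coverage and total weight together. *)
Lemma greedy_cover (R : realFieldType) (Om B : finType) (X : Om -> {set B}) (wt : Om -> R)
    (U : {set B}) (x t kappa : R) :
  0 <= kappa -> x <= 1 -> (0 < #|Om|)%N ->
  (forall b, b \in U -> x * #|Om|%:R <= #|[set w | b \in X w]|%:R) ->
  \sum_w wt w <= t * #|Om|%:R ->
  forall r, exists s : seq Om,
    #|U :\: \bigcup_(w <- s) X w|%:R + kappa * \sum_(w <- s) wt w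
    <= (1 - x) ^+ r * #|U|%:R + kappa * t * r%:R.
Proof.
move=> kappa0 x1 Om0 cov sumwt r.
elim: r U cov => [|r IH] U cov.
  by exists [::]; rewrite !big_nil setD0 expr0 !mulr0 mul1r.
have [w0 hw0] : exists w, (1 - x) ^+ r * #|U :\: X w|%:R + kappa * wt w <=
    (1 - x) ^+ r.+1 * #|U|%:R + kappa * t.
  pose v w := (1 - x) ^+ r * #|U :\: X w|%:R + kappa * wt w.
  pose avg := (1 - x) ^+ r.+1 * #|U|%:R + kappa * t.
  have [/existsP//|/existsPn nle] := boolP [exists w, v w <= avg].
  have [w1 _] := card_gt0P Om0.
  have lt : \sum_(w : Om) avg < \sum_w v w.
    by apply: ltr_sum => [|w _]; [apply/hasP; exists w1; rewrite ?mem_index_enum | rewrite ltNge nle].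
  have : \sum_w v w <= avg * #|Om|%:R.
    rewrite big_split /= -!mulr_sumr mulrDl lerD //; last by rewrite -mulrA ler_wpM2l.
    rewrite exprSr -!mulrA ler_wpM2l ?exprn_ge0 ?subr_ge0 //.
    have -> : \sum_w #|U :\: X w|%:R = \sum_(b in U) #|[set w | b \notin X w]|%:R :> R.
      under eq_bigr do rewrite -sum1_card natr_sum big_mkcond.
      rewrite exchange_big [RHS]big_mkcond; apply: eq_bigr => b _ /=.
      case: (boolP (b \in U)) => bU; last by rewrite big1 // => w _; rewrite inE (negbTE bU) andbF.
      rewrite -sum1_card natr_sum [RHS]big_mkcond; apply: eq_bigr => w _.
      by rewrite !inE bU andbT.
    have -> : (1 - x) * (#|U|%:R * #|Om|%:R) = \sum_(b in U) (1 - x) * #|Om|%:R.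
      by rewrite sumr_const -mulr_natr; ring.
    apply: ler_sum => b bU; have := cov b bU.
    have -> : #|[set w | b \notin X w]| = (#|Om| - #|[set w | b \in X w]|)%N.
      by rewrite -(cardsC [set w | b \in X w]) addKn; apply: eq_card => w; rewrite !inE.
    by rewrite natrB ?max_card //; lra.
  have -> : avg * #|Om|%:R = \sum_(w : Om) avg by rewrite sumr_const mulr_natr.
  by rewrite leNgt lt.
have [|s hs] := IH (U :\: X w0); first by move=> b /setDP[/cov].
exists (w0 :: s); rewrite !big_cons mulrDr addrCA -setDDl.
apply: (le_trans (lerD (lexx _) hs)); rewrite addrA -natr1 mulrDr mulr1.
by move: hw0; lra.
Qed.

(** * Rank-deficient matrices and completion to a basis *)

Section RankCounting.
Variable F : finFieldType.

(** Union bound over the nonzero vectors of a left kernel. *)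
Lemma card_rank_deficient a n :
  (#|[set D : 'M[F]_(a, n) | ~~ row_free D]| * #|F| ^ n <= #|F| ^ a * #|F| ^ (a * n))%N.
Proof.
have sub : ([set D : 'M[F]_(a, n) | ~~ row_free D] \subset
    \bigcup_(v in [set v : 'rV[F]_a | v != 0]) [set D | v *m D == 0]).
  apply/subsetP => D; rewrite inE -kermx_eq0 => /rowV0Pn[v vD v0].
  by apply/bigcupP; exists v; rewrite inE // (sub_kermxP vD).
apply: leq_trans (leq_mul (subset_leq_card sub) (leqnn _)) _.
apply: leq_trans (leq_mul (card_bigcup_le _ _ _) (leqnn _)) _.
rewrite big_distrl /=.
under eq_bigr => v do [rewrite inE => v0; rewrite card_mx_annihilating //].
rewrite sum_nat_const leq_mul2r; apply/orP; right.
by apply: leq_trans (max_card _) _; rewrite card_mx mul1n.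
Qed.

Lemma row_free_completion p r (b : 'M[F]_(r, r + p)) : row_free b ->
  exists2 U, U \in unitmx & b *m U = row_mx 1%:M 0.
Proof.
move=> bfree.
pose V : 'M[F]_(r + p) := block_mx (invmx (col_ebase b)) 0 0 1%:M.
exists (invmx (row_ebase b) *m V).
  rewrite unitmx_mul unitmx_inv row_ebase_unit /V unitmxE det_lblock det1 mulr1 -unitmxE.
  by rewrite unitmx_inv col_ebase_unit.
rewrite -{1}(mulmx_ebase b) (eqP bfree) mulmxA mulmxK ?row_ebase_unit //.
rewrite pid_mx_row mul_mx_row mulmx1 mulmx0 mul_row_block !mulmx0 !mul0mx !addr0.
by rewrite mulmxV ?col_ebase_unit.
Qed.

End RankCounting.

(** * From unbalanced fibres to planes of exceptional points *)

Section HashPlanes.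
Variables (R : realFieldType) (F : finFieldType) (n p : nat) (S : {set 'rV[F]_n}).
Variables (e0 tau : R) (h : nat).
Let q : R := #|F|%:R.

(** Serves at two levels: for [r = p] the fibres are the shifts of a kernel, for [r = 2 + p] they
    are the small fibres of the hash. *)
Definition deviating r (C : 'M[F]_(n, r)) (mu lam : R) : {set 'rV[F]_r} :=
  [set y | lam < `| #|hash_fiber S C y|%:R - mu |].

Definition rich_planes (T : {set 'rV[F]_(2 + p)}) : {set 'M[F]_(2, 2 + p)} :=
  [set b | [exists a : 'rV_(2 + p),
    (h * #|[set t : 'rV_2 | (a + t *m b)%R \notin T]| <= #|F| ^ 2)%N]].

(** In coordinates where [b] spans the first two axes, C consists of independent blocks E and D. If
    D has a deviating fibre over [v], the fibres of C along the plane of direction [b] determined by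
    [v] are those of E on that fibre, so [unbalanced_hash_fibers] applies to half of all E. *)
Lemma rich_planes_likely (b : 'M[F]_(2, 2 + p)) :
  row_free b -> 0 < e0 -> 0 < tau -> (8 * h)%:R * (1 + tau) <= tau ^+ 2 * e0 ->
  q ^+ (n * 2) * #|[set D : 'M[F]_(n, p) |
                     deviating D (q ^+ 2 * e0) (tau * (q ^+ 2 * e0)) != set0]|%:R
  <= 2 * #|[set C : 'M[F]_(n, 2 + p) | b \in rich_planes (deviating C e0 (tau / 2 * e0))]|%:R.
Proof.
move=> bfree e0_gt0 tau0 large.
have [U Uunit bU] := row_free_completion bfree.
have q2 : 0 < q ^+ 2 by rewrite exprn_gt0 // ltr0n (ltnW (finNzRing_gt1 F)).
set Bad := [set D | _].
pose G (D : 'M[F]_(n, p)) (v : 'rV[F]_p) := [set E : 'M[F]_(n, 2) | (h *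
  #|[set e | (`| #|hash_fiber (hash_fiber S D v) E e|%:R - e0 | <= tau / 2 * e0)%R]|
    <= #|F| ^ 2)%N].
pose Good D := [set E : 'M[F]_(n, 2) | [exists v, E \in G D v]].
pose Psi (ED : 'M[F]_(n, 2) * 'M[F]_(n, p)) := row_mx ED.1 ED.2 *m invmx U.
have PsiI : injective Psi.
  move=> [E D] [E' D'] /(congr1 (mulmx^~ U)); rewrite !mulmxKV //=.
  by case/eq_row_mx => -> ->.
pose P := [set ED : 'M[F]_(n, 2) * 'M[F]_(n, p) | ED.1 \in Good ED.2].
have subP : Psi @: P \subset
    [set C : 'M[F]_(n, 2 + p) | b \in rich_planes (deviating C e0 (tau / 2 * e0))].
  apply/subsetP => _ /imsetP[[E D] /[!inE] /= /existsP[v] /[!inE] Ev ->].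
  apply/existsP; exists (row_mx 0 v *m invmx U).
  apply: leq_trans Ev; rewrite leq_mul2l; apply/orP; right; apply: subset_leq_card.
  apply/subsetP => t; rewrite !inE -leNgt.
  suff -> : hash_fiber S (Psi (E, D)) (row_mx 0 v *m invmx U + t *m b) =
            hash_fiber (hash_fiber S D v) E t by [].
  apply/setP => x; rewrite !inE -andbA; congr (_ && _).
  rewrite -(inj_eq (can_inj (mulmxK Uunit))) /Psi /= mulmxDl mulmxA !mulmxKV //.
  rewrite -[t *m b *m U]mulmxA bU !mul_mx_row mulmx1 mulmx0 add_row_mx add0r addr0.
  by apply/eqP/andP => [/eq_row_mx[-> ->]|[/eqP-> /eqP->]].
have -> : q ^+ (n * 2) * #|Bad|%:R = \sum_(D in Bad) q ^+ (n * 2).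
  by rewrite sumr_const mulr_natr.
apply: (@le_trans _ _ (2 * #|P|%:R)); last first.
  by rewrite ler_pM2l // ler_nat -(card_imset _ PsiI) subset_leq_card.
have -> : #|P|%:R = \sum_D #|Good D|%:R :> R.
  rewrite -natr_sum -sum1_card (partition_big (fun ED => ED.2) predT) //=.
  congr (_%:R); apply: eq_bigr => D _; rewrite sum1dep_card.
  have pI : injective (fun E : 'M[F]_(n, 2) => (E, D)) by move=> E E' [].
  transitivity #|[set (E, D) | E in Good D]|; last by rewrite card_imset.
  apply: eq_card => -[E D']; rewrite inE /= inE.
  apply/andP/imsetP => [[gE /eqP <-]|[E' gE [-> ->]]]; last by rewrite eqxx.
  by exists E.
rewrite mulr_sumr big_mkcond /=; apply: ler_sum => D _.
case: ifP => [|_]; last by rewrite mulr_ge0.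
rewrite inE => /set0Pn[v]; rewrite inE => dev.
apply: le_trans (@unbalanced_hash_fibers R F n (hash_fiber S D v) e0 tau h _ _ _ _) _ => //.
  rewrite -(ltr_pM2r q2) -[X in _ < _ * X]gtr0_norm // -normrM mulrBl divfK ?gt_eqF //.
  have -> : tau * e0 * q ^+ 2 = tau * (q ^+ 2 * e0) by ring.
  by rewrite [e0 * q ^+ 2]mulrC.
rewrite ler_pM2l // ler_nat subset_leq_card //; apply/subsetP => E EG.
by rewrite inE; apply/existsP; exists v.
Qed.

End HashPlanes.

Lemma expr_onem_le (R : realFieldType) (x : R) r : 0 <= x <= 1 ->
  (1 - x) ^+ r * (1 + x * r%:R) <= 1.
Proof.
case/andP=> x0 x1; elim: r => [|r IH]; first by rewrite expr0 mulr0 addr0 mul1r.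
apply: le_trans IH; rewrite exprSr -mulrA ler_wpM2l ?exprn_ge0 ?subr_ge0 //.
rewrite -natr1 -subr_ge0.
have -> : 1 + x * r%:R - (1 - x) * (1 + x * (r%:R + 1)) = x ^+ 2 * (r%:R + 1) by ring.
by rewrite mulr_ge0 ?sqr_ge0 ?addr_ge0.
Qed.

Lemma deviating_rare (R : realFieldType) (F : finFieldType) n p (S : {set 'rV[F]_n})
    (e0 tau delta : R) (r : nat) :
  (0 < p)%N -> (28 * (2 + p) <= #|F|)%N -> 0 < e0 -> 0 < tau -> 0 < delta <= 1 ->
  #|S|%:R = e0 * #|F|%:R ^+ (2 + p) ->
  (8 * (8 * (2 + p)))%:R * (1 + tau) <= tau ^+ 2 * e0 ->
  540 <= delta * (tau ^+ 2 * e0) ->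
  8 <= delta * r%:R <= 9 ->
  #|[set D : 'M[F]_(n, p) |
       deviating S D (#|F|%:R ^+ 2 * e0) (tau * (#|F|%:R ^+ 2 * e0)) != set0]|%:R
  < delta / 2 * #|F|%:R ^+ (n * p).
Proof.
move=> p0 qm e0_gt0 tau0 /andP[d0 d1] SE large1 large2 /andP[r8 r9].
set q : R := #|F|%:R in SE *; set m := (2 + p)%N in qm SE large1 *.
rewrite ltNge; apply/negP => bad.
have q_gt0 : 0 < q by rewrite ltr0n (ltnW (finNzRing_gt1 F)).
pose T (C : 'M[F]_(n, m)) := deviating S C e0 (tau / 2 * e0).
pose X (C : 'M[F]_(n, m)) := rich_planes (8 * m) (T C).
pose U := [set b : 'M[F]_(2, m) | row_free b].
pose V := tau ^+ 2 * e0.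
have V0 : 0 < V by rewrite mulr_gt0 ?exprn_gt0.
have cardC : #|{: 'M[F]_(n, m)}|%:R = q ^+ (n * m) :> R by rewrite card_mx natrX.
(* The assumed density [delta / 2] of deviating D is halved by [rich_planes_likely]. *)
have cov b : b \in U -> delta / 4 * #|{: 'M[F]_(n, m)}|%:R <= #|[set C | b \in X C]|%:R.
  rewrite inE cardC => bfree.
  have := @rich_planes_likely R F n p S e0 tau (8 * m) b bfree e0_gt0 tau0 large1.
  rewrite -/q -/m => le.
  have : q ^+ (n * 2) * (delta / 2 * q ^+ (n * p)) <= 2 * #|[set C | b \in X C]|%:R.
    by apply: le_trans le; rewrite ler_pM2l ?exprn_gt0.
  have -> : q ^+ (n * m) = q ^+ (n * 2) * q ^+ (n * p) by rewrite -exprD -mulnDr.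
  by move: (q ^+ (n * 2)) (q ^+ (n * p)) => a c; rewrite mulrCA; lra.
have sumT : \sum_C #|T C|%:R <= (4 * q ^+ m / V) * #|{: 'M[F]_(n, m)}|%:R.
  have lam0 : 0 <= tau / 2 * e0 by rewrite mulr_ge0 ?divr_ge0 // ltW.
  have := hash_chebyshev m S lam0; rewrite SE -/q mulfK ?expf_neq0 ?gt_eqF // => cheb.
  have le : \sum_C #|T C|%:R <= \sum_(C : 'M[F]_(n, m)) #|[set e | tau / 2 * e0 <= `| #|hash_fiber S C e|%:R - e0 |]|%:R :> R.
    apply: ler_sum => C _; rewrite ler_nat subset_leq_card //.
    by apply/subsetP => y; rewrite !inE => /ltW.
  apply: (le_trans le); move: cheb; rewrite cardC; set Sg := \sum_C _ => cheb.
  have -> : 4 * q ^+ m / V * q ^+ (n * m) = (q ^+ (n * m) * (e0 * q ^+ m)) * 4 / (V * e0).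
    by rewrite /V; field; rewrite !gt_eqF.
  rewrite ler_pdivlMr ?mulr_gt0 //.
  have : (tau / 2 * e0) ^+ 2 * Sg = Sg * (V * e0) / 4 by rewrite /V; field.
  by lra.
(* The weight 3/2 q^m puts points and directions on the common scale q^(2m). The uncovered share is
   at most 1/3 because x r >= 2, and the cost share at most 54/540 = 1/10: together 13/30. *)
have ka0 : 0 <= 3 / 2 * q ^+ m by rewrite mulr_ge0 ?exprn_ge0 ?divr_ge0 // ltW.
have x1 : delta / 4 <= 1 by lra.
have Om0 : (0 < #|{: 'M[F]_(n, m)}|)%N by rewrite card_mx expn_gt0 (ltnW (finNzRing_gt1 F)).
have [s hs] := greedy_cover ka0 x1 Om0 cov sumT r.
pose Tall := \bigcup_(C <- s) T C.
pose Xall := U :&: \bigcup_(C <- s) X C.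
pose Q := q ^+ m; have Q0 : 0 < Q by rewrite exprn_gt0.
have QQ : q ^+ (2 * m) = Q * Q by rewrite mulnC exprM expr2.
have Ule : #|U|%:R <= Q * Q.
  by rewrite -QQ /q -natrX ler_nat -card_mx max_card.
have total : #|U :\: \bigcup_(C <- s) X C|%:R + 3 / 2 * Q * \sum_(C <- s) #|T C|%:R
    <= 13 / 30 * (Q * Q).
  apply: (le_trans hs).
  have p1 : (1 - delta / 4) ^+ r <= 1 / 3.
    have x01 : 0 <= delta / 4 <= 1 by lra.
    have := expr_onem_le r x01; have : 0 <= (1 - delta / 4) ^+ r by rewrite exprn_ge0; lra.
    by move: (_ ^+ r) => y y0; nra.
  have p2 : (1 - delta / 4) ^+ r * #|U|%:R <= 1 / 3 * (Q * Q).
    apply: ler_pM => //; by rewrite exprn_ge0; lra.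
  have p3 : 3 / 2 * q ^+ m * (4 * q ^+ m / V) * r%:R <= 1 / 10 * (Q * Q).
    have -> : 3 / 2 * q ^+ m * (4 * q ^+ m / V) * r%:R = 6 * r%:R / V * (Q * Q).
      by rewrite /Q; field; rewrite gt_eqF.
    apply: ler_wpM2r; first by rewrite mulr_ge0 ?(ltW Q0).
    rewrite ler_pdivrMr //.
    rewrite -(ler_pM2l d0); move: large2; rewrite -/V; nra.
  by lra.
have S0 : 0 <= \sum_(C <- s) #|T C|%:R :> R by apply: sumr_ge0.
have TallE : #|Tall|%:R <= \sum_(C <- s) #|T C|%:R :> R.
  by rewrite -natr_sum ler_nat card_bigcup_le.
(* Rank-deficient directions have density at most q^-p <= 1/28, so more than a quarter of all
   directions end up rich. *)
have Ubig : 27 / 28 * (Q * Q) <= #|U|%:R.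
  have := @card_rank_deficient F 2 m.
  have -> : [set D : 'M[F]_(2, m) | ~~ row_free D] = ~: U by apply/setP => D; rewrite !inE.
  have qq : (0 < #|F|)%N := ltnW (finNzRing_gt1 F).
  have -> : (#|F| ^ m = #|F| ^ 2 * #|F| ^ p)%N by rewrite -expnD.
  rewrite mulnCA leq_pmul2l ?expn_gt0 ?qq // => def.
  have def' : (#|~: U| * 28 <= #|F| ^ (2 * m))%N.
    apply: leq_trans def; rewrite leq_mul2l; apply/orP; right.
    apply: (@leq_trans (#|F| ^ 1)%N); last by rewrite leq_exp2l ?finNzRing_gt1.
    by rewrite expn1 (leq_trans _ qm) // leq_pmulr.
  have := cardsC U; rewrite card_mx => cU.
  have : (27 * #|F| ^ (2 * m) <= 28 * #|U|)%N.
    by move: def' cU; move: (_ ^ _)%N #|U| #|~: U| => N0 u v; clear; lia.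
  by rewrite -(ler_nat R) (natrM _ 27) (natrM _ 28) natrX -/q QQ; lra.
have richX b : b \in Xall -> exists a : 'rV_m,
    (8 * m * #|[set t : 'rV_2 | (a + t *m b)%R \notin Tall]| <= #|F| ^ 2)%N.
  case/setIP => _; rewrite in_bigcup_seq => /hasP[C Cs bX].
  move: bX; rewrite inE => /existsP[a ha]; exists a; apply: leq_trans ha.
  rewrite leq_mul2l subset_leq_card ?orbT //; apply/subsetP => t; rewrite !inE -!leNgt.
  move=> nT; rewrite leNgt; apply: contra nT => tT.
  by rewrite in_bigcup_seq; apply/hasP; exists C; rewrite // inE.
have Xbig : (#|F| ^ (2 * m) <= 4 * #|Xall|)%N.
  have := cardsID (\bigcup_(C <- s) X C) U; rewrite -/Xall => /(congr1 (fun k => k%:R : R)).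
  rewrite natrD => cU; rewrite -(ler_nat R) (natrM _ 4) natrX -/q QQ.
  have : 0 <= 3 / 2 * Q * \sum_(C <- s) #|T C|%:R by apply: mulr_ge0 S0; apply: mulr_ge0 (ltW Q0); lra.
  by move: total Ubig; lra.
have := kakeya_planes_half (ltn0Sn _) qm richX Xbig.
rewrite -(ler_nat R) natrX (natrM _ 2) -/q -/Q => final.
have : 0 <= #|U :\: \bigcup_(C <- s) X C|%:R :> R by [].
move: TallE total final; rewrite -/Tall; move: (\sum_(C <- s) _) S0 => Sg Sg0.
move: (#|Tall|%:R) => k le1 le2 le3 le4.
(* The union thus has at most 13/45 of all points, while the Kakeya bound demands half. *)
have : 3 / 2 * Sg <= 13 / 30 * Q by rewrite -(ler_pM2l Q0); lra.
by lra.
Qed.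

(** * Subspaces as kernels *)

Section Kernels.
Variables (F : finFieldType) (n k : nat).
Hypothesis kn : (k <= n)%N.
Let p := (n - k)%N.

Definition left_kernel (D : 'M[F]_(n, p)) : {set 'rV[F]_n} := [set v | v *m D == 0].

Let fib (A : {set 'rV[F]_n}) : {set 'M[F]_(n, p)} :=
  [set D | (\rank D == p) && (left_kernel D == A)].

Lemma left_kernel_linsubs D : \rank D = p -> left_kernel D \in linsubs F n k.
Proof.
move=> rD; apply/imsetP; exists (kermx D); first by rewrite inE mxrank_ker rD subKn.
by apply/setP => v; rewrite !inE; apply/eqP/sub_kermxP.
Qed.

(** An invertible [g] carries one subspace to the other, and left multiplication by [g] injects the
    matrices with one kernel into those with the other. *)
Lemma card_kernel_fiber_le A A' :
  A \in linsubs F n k -> A' \in linsubs F n k -> (#|fib A| <= #|fib A'|)%N.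
Proof.
have subE (M : 'M[F]_n) (x : 'rV_n) :
    (x <= M)%MS = (x *m invmx (row_ebase M) <= (pid_mx (\rank M) : 'M_n))%MS.
  rewrite -{1}(mulmx_ebase M) -mulmxA.
  have full : row_full (col_ebase M) by rewrite row_full_unit col_ebase_unit.
  rewrite (eqmxMfull _ full).
  rewrite -{1}[x](mulmxKV (row_ebase_unit M)) submxMfree //.
  by rewrite row_free_unit row_ebase_unit.
case/imsetP => M /[!inE] /eqP rM -> /imsetP[M' /[!inE] /eqP rM' ->].
pose g := invmx (row_ebase M') *m row_ebase M.
have gU : g \in unitmx by rewrite unitmx_mul unitmx_inv !row_ebase_unit.
have gI : injective (mulmx g : 'M[F]_(n, p) -> _) by apply: can_inj (mulKmx gU).
rewrite -(card_imset _ gI); apply: subset_leq_card; apply/subsetP => _ /imsetP[D DA ->].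
move: DA; rewrite !inE => /andP[rD /eqP kD].
rewrite (eqmxMfull _ _) ?rD ?row_full_unit //=; apply/eqP/setP => v; rewrite !inE mulmxA.
have := congr1 (fun B : {set 'rV[F]_n} => v *m g \in B) kD; rewrite !inE => ->.
rewrite [RHS]subE [LHS]subE rM rM' /g mulmxA mulmxK // row_ebase_unit //.
Qed.

(** All fibres having equal size, the kernel of a uniform full-rank matrix is a uniform subspace;
    the identity of densities is cleared of denominators. *)
Lemma card_full_rank_kernel (P : pred {set 'rV[F]_n}) :
  (#|[set D : 'M[F]_(n, p) | (\rank D == p) && P (left_kernel D)]| * #|linsubs F n k| =
   #|[set D : 'M[F]_(n, p) | \rank D == p]| * #|[set A in linsubs F n k | P A]|)%N.
Proof.
have cardE (P' : pred {set 'rV[F]_n}) :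
    #|[set D : 'M[F]_(n, p) | (\rank D == p) && P' (left_kernel D)]| =
    (\sum_(A in [set A in linsubs F n k | P' A]) #|fib A|)%N.
  rewrite -sum1dep_card (partition_big left_kernel (mem [set A in linsubs F n k | P' A])) /=.
    apply: eq_bigr => A /[!inE] /andP[_ PA]; rewrite sum1dep_card; apply: eq_card => D.
    by rewrite !inE; have [->|_] := eqVneq (left_kernel D) A; rewrite ?PA ?andbT ?andbF.
  by move=> D /andP[/eqP rD PD]; rewrite !inE PD left_kernel_linsubs.
have [E|/set0Pn[A0 A0l]] := eqVneq (linsubs F n k) set0.
  by rewrite E cards0 muln0 (_ : [set A in set0 | P A] = set0) ?cards0 ?muln0 //; apply/setP => A; rewrite !inE.
have fibE A : A \in linsubs F n k -> #|fib A| = #|fib A0|.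
  by move=> Al; apply/eqP; rewrite eqn_leq !card_kernel_fiber_le.
rewrite cardE.
have -> : #|[set D : 'M[F]_(n, p) | \rank D == p]| = (\sum_(A in linsubs F n k) #|fib A|)%N.
  transitivity #|[set D : 'M[F]_(n, p) | (\rank D == p) && predT (left_kernel D)]|.
    by apply: eq_card => D; rewrite !inE andbT.
  by rewrite cardE; apply: eq_bigl => A; rewrite !inE andbT.
rewrite (eq_bigr (fun _ => #|fib A0|)) => [|A /[!inE] /andP[Al _]]; last exact: fibE.
rewrite [X in (_ = X * _)%N](eq_bigr (fun _ => #|fib A0|)) => [|A Al]; last exact: fibE.
by rewrite !sum_nat_const mulnC mulnA mulnAC.
Qed.

Lemma card_full_rank : (0 < k)%N ->
  (#|F| ^ (n * p) <= 2 * #|[set D : 'M[F]_(n, p) | \rank D == p]|)%N.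
Proof.
move=> k0; set G := [set D | _].
have := @card_rank_deficient F p n.
have -> : #|[set D : 'M[F]_(p, n) | ~~ row_free D]| = #|~: G|.
  rewrite -(card_imset _ (@trmx_inj _ n p)); apply: eq_card => D; rewrite inE.
  apply/idP/imsetP => [nf|[D' + ->]]; last by rewrite !inE /row_free mxrank_tr.
  by exists D^T; rewrite ?trmxK // !inE mxrank_tr.
have -> : (#|F| ^ n = #|F| ^ p * #|F| ^ k)%N by rewrite -expnD subnK.
rewrite mulnCA leq_pmul2l ?expn_gt0 ?(ltnW (finNzRing_gt1 F)) // => def.
have def2 : (#|~: G| * 2 <= #|F| ^ (n * p))%N.
  rewrite [(n * p)%N]mulnC; apply: leq_trans def; rewrite leq_mul2l; apply/orP; right.
  apply: leq_trans (finNzRing_gt1 F) _; rewrite -{1}[#|F|]expn1.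
  by rewrite leq_exp2l ?finNzRing_gt1.
have := cardsC G; rewrite card_mx; move: def2.
by move: (#|F| ^ (n * p))%N #|G| #|~: G| => N u v; clear; lia.
Qed.

Lemma deviating_of_unbalanced (R : realType) (tau : R) (S : {set 'rV[F]_n}) (D : 'M[F]_(n, p)) :
  ~~ shift_balanced k tau S (left_kernel D) ->
  deviating S D (Ek R k S) (tau * Ek R k S) != set0.
Proof.
case/forallPn => a; rewrite /balanced -ltNge => dev; apply/set0Pn; exists (a *m D).
rewrite inE; suff -> : hash_fiber S D (a *m D) = shift (left_kernel D) a :&: S by [].
apply/setP => x; rewrite !inE andbC; congr (_ && _).
apply/eqP/imsetP => [e|[v + ->]]; last by rewrite inE mulmxDl => /eqP ->; rewrite add0r.
by exists (x - a); rewrite ?subrK // inE mulmxBl e subrr.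
Qed.

End Kernels.

(** At least half of all matrices have full rank, and their kernels are uniform; a shift of the
    kernel is a fibre, so unbalanced kernels give deviating matrices. *)
Lemma deviating_count_of_unbalanced (R : realType) (F : finFieldType) n k
    (S : {set 'rV[F]_n}) (tau delta : R) :
  (0 < k <= n)%N -> 0 < delta ->
  #|[set A in linsubs F n k | shift_balanced k tau S A]|%:R
    < (1 - delta) * #|linsubs F n k|%:R ->
  delta / 2 * #|F|%:R ^+ (n * (n - k)) <=
  #|[set D : 'M[F]_(n, n - k) | deviating S D (Ek R k S) (tau * Ek R k S) != set0]|%:R.
Proof.
case/andP=> k0 kn d0 few.
have := card_full_rank_kernel kn (fun A => ~~ shift_balanced k tau S A).
set N1 := #|_|; set L := #|linsubs F n k| in few *; set N := #|_|; set b := #|_| => countE.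
have half : (#|F| ^ (n * (n - k)) <= 2 * N)%N := card_full_rank F kn k0.
have split_count : (#|[set A in linsubs F n k | shift_balanced k tau S A]| + b = L)%N.
  rewrite /L -(cardsID [set A | shift_balanced k tau S A] (linsubs F n k)).
  by congr (_ + _)%N; apply: eq_card => A; rewrite !inE // andbC.
have L0 : 0 < L%:R :> R.
  rewrite lt0r ler0n andbT; apply: contraTneq few => ->.
  by rewrite mulr0 -leNgt.
have bE : delta * L%:R <= b%:R.
  by move: few; rewrite -split_count natrD; lra.
have N1le : N1%:R <= #|[set D : 'M[F]_(n, n - k) |
    deviating S D (Ek R k S) (tau * Ek R k S) != set0]|%:R :> R.
  rewrite ler_nat subset_leq_card //; apply/subsetP => D; rewrite !inE => /andP[_].
  exact: deviating_of_unbalanced.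
apply: le_trans N1le; rewrite -(ler_pM2r L0).
have -> : N1%:R * L%:R = N%:R * b%:R :> R by rewrite -!natrM countE.
have half' : #|F|%:R ^+ (n * (n - k)) <= 2 * N%:R :> R.
  by rewrite -natrX -(natrM _ 2) ler_nat.
have : N%:R * (delta * L%:R) <= N%:R * b%:R :> R by rewrite ler_wpM2l.
apply: le_trans.
have dL : 0 <= delta * L%:R by rewrite mulr_ge0 ?ltW.
have := ler_wpM2r dL half'; move: (_ ^+ _) => Q; lra.
Qed.

(** * Assembly and choice of constants *)

Theorem mainTheorem9 (R : realType) (eta : R) :
  0 < eta <= 1 ->
  exists C : R, 0 < C /\
  forall (F : finFieldType) (n : nat) (S : {set 'rV[F]_n}),
    (5 <= n)%N -> (#|F| ^ 4 < #|S|)%N ->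
  forall (tau delta : R) (k : nat),
    0 < tau -> 0 < delta < 1 ->
    C * Num.max (n%:R * (1 + tau) / (tau * delta) ^+ 2) n%:R
      <= powR (#|F|%:R) eta ->
    (1 <= k <= n)%N ->
    powR (#|F|%:R) ((n + 2)%:R + eta) < (#|F| ^ k * #|S|)%:R ->
    (1 - delta) * #|linsubs F n k|%:R
      <= #|[set A in linsubs F n k
             | shift_balanced k tau S A]|%:R.
Proof.
(* As 2 + p <= 2n, the value 1000 dominates 28 * 2 for the field size and 64 * 2 for the Chebyshev
   condition; 1000 n also exceeds 540. *)
case/andP=> eta0 eta1; exists 1000; split=> // F n S n5 _ tau delta k tau0 /andP[d0 d1] hC kn hS.
rewrite leNgt; apply/negP => few.
have dev := deviating_count_of_unbalanced kn d0 few.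
case/andP: kn => k0 kn; set p := (n - k)%N in dev.
have q1 : 1 < #|F|%:R :> R by rewrite ltr1n finNzRing_gt1.
set q : R := #|F|%:R in hC hS dev q1; have q_gt0 : 0 < q := lt_trans ltr01 q1.
have n0 : 5 <= n%:R :> R by rewrite (ler_nat R 5).
have [hC1 hC2] : 1000 * (n%:R * (1 + tau) / (tau * delta) ^+ 2) <= powR q eta /\
    1000 * n%:R <= powR q eta.
  by split; apply: le_trans hC; rewrite ler_pM2l // le_max lexx ?orbT.
have qeta : powR q eta <= q by rewrite -{2}[q]powRr1 ?ler_powR // ltW.
(* The mean fibre size of the hash; since n + 2 = k + (2 + p), the hypothesis on [#|S|] says exactly
   that it exceeds q^eta. *)
pose e0 : R := #|S|%:R / q ^+ (2 + p).
have SE : #|S|%:R = e0 * q ^+ (2 + p) by rewrite divfK // expf_neq0 // gt_eqF.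
have e0_big : powR q eta < e0.
  have qn : q ^+ (n + 2) = q ^+ k * q ^+ (2 + p).
    by rewrite -exprD; congr (_ ^+ _); rewrite /p addnCA subnKC // addnC.
  have : q ^+ k * q ^+ (2 + p) * powR q eta < q ^+ k * (e0 * q ^+ (2 + p)).
    rewrite -SE -qn -powR_mulrn ?(ltW q_gt0) // -powRD; last by rewrite (gt_eqF q_gt0) implybT.
    by move: hS; rewrite natrM natrX.
  by rewrite -mulrA ltr_pM2l ?exprn_gt0 // mulrC ltr_pM2r ?exprn_gt0.
have e0_gt0 : 0 < e0 by apply: le_lt_trans e0_big; apply: powR_ge0.
have EkE : Ek R k S = q ^+ 2 * e0.
  by rewrite /Ek -/p -/q SE exprD; field; rewrite expf_neq0 ?gt_eqF.
rewrite EkE in dev.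
(* For k = n a matrix without columns has the single fibre [S], which cannot deviate. *)
have p0 : (0 < p)%N.
  rewrite lt0n; apply/eqP => pE; move: dev; apply/negP; rewrite -ltNge.
  rewrite (_ : [set D | _] = set0) ?cards0; last first.
    apply/setP => D; rewrite !inE; apply/negbTE; rewrite negbK.
    apply/eqP/setP => y; rewrite !inE; apply/negbTE; rewrite -leNgt.
    have -> : hash_fiber S D y = S.
      apply/setP => x; rewrite inE andb_idr // => _; apply/eqP/rowP => i.
      by have := ltn_ord i; rewrite {2}pE ltn0.
    rewrite SE pE addn0 [e0 * _]mulrC subrr normr0.
    by rewrite mulr_ge0 ?(ltW tau0) // mulr_ge0 ?exprn_ge0 ?(ltW q_gt0) ?(ltW e0_gt0).
  by rewrite mulr_gt0 ?exprn_gt0 // divr_gt0.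
pose V := tau ^+ 2 * e0.
have Vbig : 1000 * (n%:R * (1 + tau)) <= delta ^+ 2 * V.
  have td : 0 < (tau * delta) ^+ 2 by rewrite exprn_gt0 // mulr_gt0.
  have : 1000 * (n%:R * (1 + tau) / (tau * delta) ^+ 2) <= e0.
    by apply: le_trans hC1 (ltW e0_big).
  rewrite mulrA ler_pdivrMr // => le; apply: (le_trans le).
  by rewrite /V le_eqVlt; apply/orP; left; apply/eqP; ring.
have V0 : 0 < V by rewrite mulr_gt0 ?exprn_gt0.
have dd : delta ^+ 2 * V <= delta * V.
  by rewrite ler_pM2r // expr2 ler_piMr // ltW.
have dV : delta * V <= V by rewrite ler_piMl // ltW.
have nt : n%:R <= n%:R * (1 + tau) by rewrite ler_peMr //; lra.
have pn : (2 + p)%:R <= 2 * n%:R :> R.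
  by rewrite -(natrM _ 2) ler_nat /p; move: n5 k0 kn; clear; lia.
(* Rounding 8 / delta up adds at most 1, hence at most [delta < 1] to [delta * r]. *)
pose r := (Num.truncn (8 / delta)).+1.
have /andP[r1 r2] : 8 <= delta * r%:R <= 9.
  have := truncn_itv (_ : 0 <= 8 / delta); rewrite divr_ge0 ?(ltW d0) // => /(_ isT).
  rewrite -/r => /andP[]; rewrite ler_pdivlMr // ltr_pdivrMr // => lo hi.
  by rewrite mulrC ltW //= /r -natr1 mulrDl; lra.
move: dev; apply/negP; rewrite -ltNge.
apply: (@deviating_rare R F n p S e0 tau delta r) => //.
- rewrite -(ler_nat R) (natrM _ 28) -/q; lra.
- by rewrite d0 ltW.
- rewrite (natrM _ 8) (natrM _ 8) -/V; apply: (@le_trans _ _ (1000 * (n%:R * (1 + tau)))); last by lra.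
  have := ler_wpM2r (_ : 0 <= 1 + tau) pn; nra.
- by rewrite -/V; lra.
- by rewrite r1.
Qed.
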